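(* Let $\mathbb A$ be a Weil algebra. For every $Q\in\mathrm{SO}(3,\mathbb A)$ there exists $B\in\mathfrak{so}(3,\mathbb A)$ such that $Q=\operatorname{Exp}_{\mathbb A}(B)$. Hence every $Q\in \mathrm{SO}(3,\mathbb A)$ has an exact unnormalised Rodrigues representation: there is $\phi\in\mathbb A^3$ such that, with $B=[\phi]_\times$ and $S=\phi^T\phi\in\mathbb A$, $$Q=\operatorname{Exp}_{\mathbb A}(B)=I+a_{\mathbb A}(S)\,B+b_{\mathbb A}(S)\,B^2 .$$
   Context: A Weil algebra is a finite-dimensional, commutative, associative real algebra with unit of the form $\mathbb A=\mathbb R 1_{\mathbb A}\oplus\mathfrak m$, where $\mathfrak m$ is the unique maximal ideal and $\mathfrak m^{N+1}=0$, $\mathfrak m^N\neq 0$; $N$ is its nilpotency index. The scalar-part projection $\pi:\mathbb A\to\mathbb R$ is the algebra morphism with kernel $\mathfrak m$; it acts componentwise on $\mathbb A^p$. Finite Weil prolongation: for $U\subset\mathbb R^p$ open put $U^{\mathbb A}=\{X\in\mathbb A^p:\pi(X)\in U\}$. For $f\in C^N(U,\mathbb R^q)$, $x\in U$, $H\in\mathfrak m^p=\mathfrak m\times\cdots\times\mathfrak m$, $$(J_{\mathbb A}f)(x+H)=\sum_{|\alpha|\le N}\frac1{\alpha!}(\partial^\alpha f)(x)H^\alpha\in\mathbb A^q .$$ $M_3(\mathbb A)$ is the algebra of $3\times3$ matrices over $\mathbb A$; $\mathfrak{so}(3,\mathbb A)=\{B\in M_3(\mathbb A):B^T=-B\}$;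 $\mathrm{SO}(3,\mathbb A)=\{Q\in M_3(\mathbb A):Q^TQ=I,\ \det Q=1\}$. $\operatorname{Exp}_{\mathbb A}:M_3(\mathbb A)\to M_3(\mathbb A)$ is the finite Weil prolongation $J_{\mathbb A}\exp$ of the real matrix exponential $\exp:M_3(\mathbb R)\to M_3(\mathbb R)$ (with $M_3(\mathbb R)\cong\mathbb R^9$). For $\phi=(\phi_1,\phi_2,\phi_3)^T\in\mathbb A^3$, $$[\phi]_\times=\begin{pmatrix}0&-\phi_3&\phi_2\\ \phi_3&0&-\phi_1\\ -\phi_2&\phi_1&0\end{pmatrix}.$$ The smooth functions $a,b:\mathbb R\to\mathbb R$ are: $a(s)=\sin\sqrt s/\sqrt s$ for $s>0$, $a(0)=1$, $a(s)=\sinh\sqrt{-s}/\sqrt{-s}$ for $s<0$; $b(s)=(1-\cos\sqrt s)/s$ for $s>0$, $b(0)=1/2$, $b(s)=(\cosh\sqrt{-s}-1)/(-s)$ for $s<0$. One writes $a_{\mathbb A}=J_{\mathbb A}a$, $b_{\mathbb A}=J_{\mathbb A}b:\mathbb A\to\mathbb A$. *)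

(* Defs.v *)
From HB Require Import structures.
From mathcomp Require Import all_boot all_order all_algebra falgebra.
From mathcomp Require Import all_classical all_reals all_analysis.

Set Implicit Arguments.
Unset Strict Implicit.
Unset Printing Implicit Defensive.

Import Order.TTheory GRing.Theory Num.Theory numFieldNormedType.Exports.

Local Open Scope ring_scope.

#[short(type="comFalgType")]
HB.structure Definition ComFalgebra (R : nzRingType) :=
  {A of Falgebra R A & GRing.PzRing_hasCommutativeMul A}.

(* As A is unital, each of its ideals is a linear subspace. *)
Definition is_ideal (R : fieldType) (A : falgType R) (I : {vspace A}) : Prop :=
  (fullv * I <= I)%VS.

Definition is_maximal_ideal (R : fieldType) (A : falgType R)
    (I : {vspace A}) : Prop :=
  [/\ is_ideal I, I <> fullv &
      forall J : {vspace A}, is_ideal J -> (I <= J)%VS -> J = I \/ J = fullv].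

(* Products and powers of subspaces are those of falgebra: (U * V)%VS is the
   span of the products u * v, and (U ^+ 0)%VS = 1%VS is the line R 1_A. *)
HB.mixin Record isWeil (R : realType) A of ComFalgebra R A := {
  weil_max : {vspace A};
  weil_index : nat;
  weil_max_maximal : is_maximal_ideal weil_max;
  weil_max_unique :
    forall I : {vspace A}, is_maximal_ideal I -> I = weil_max;
  weil_sum : (1 + weil_max)%VS = fullv;
  weil_direct : directv (1 + weil_max);
  weil_nilpotent : (weil_max ^+ weil_index.+1)%VS = 0%VS;
  weil_nilpotent_sharp : (weil_max ^+ weil_index)%VS <> 0%VS
}.

#[short(type="weilAlgType")]
HB.structure Definition WeilAlgebra (R : realType) :=
  {A of isWeil R A & ComFalgebra R A}.

Arguments weil_max {R} A : rename.
Arguments weil_index {R} A : rename.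

(* The 1_A-coordinate of the projection onto R 1_A along the maximal ideal. *)
Definition scalar_part (R : realType) (A : weilAlgType R) (x : A) : R :=
  coord [tuple (1 : A)] ord0 (daddv_pi 1 (weil_max A) x).

Lemma scalar_part_unique (R : realType) (A : weilAlgType R) (r : R) (h : A) :
  h \in weil_max A -> scalar_part (r%:A + h) = r.
Proof.
have dxv : (1 :&: weil_max A = 0)%VS.
  by have := @weil_direct _ A; rewrite directvE /= => /directv_addP.
move=> hm; rewrite /scalar_part linearD /=.
rewrite [daddv_pi _ _ r%:A]daddv_pi_id //; last by rewrite rpredZ ?memv_line.
have : daddv_pi 1 (weil_max A) h = 0.
  have /= := daddv_pi_add dxv (subvP (addvSr 1 (weil_max A)) _ hm).
  rewrite [daddv_pi (weil_max A) 1 h]daddv_pi_id //; last by rewrite capvC.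
  by rewrite -[RHS]add0r => /addIr.
move=> ->; rewrite addr0 linearZ /=.
have free1 : free [tuple (1 : A)] by rewrite seq1_free oner_eq0.
have := coord_free ord0 ord0 free1.
by rewrite [X in coord _ _ X]/= => ->; rewrite mulr1.
Qed.

Lemma scalar_part_max (R : realType) (A : weilAlgType R) (x : A) :
  x - (scalar_part x)%:A \in weil_max A.
Proof.
have /memv_addP [u u1 [v vm ->]] : x \in (1 + weil_max A)%VS.
  by rewrite weil_sum memvf.
have /vlineP [k ->] := u1.
by rewrite scalar_part_unique // addrAC subrr add0r.
Qed.

Definition partial (R : realType) p q (i : 'I_p)
    (f : 'rV[R]_p -> 'rV[R]_q) : 'rV[R]_p -> 'rV[R]_q :=
  'D_(delta_mx 0 i) f.

Definition mpartial (R : realType) p q (alpha : 'I_p -> nat)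
    (f : 'rV[R]_p -> 'rV[R]_q) : 'rV[R]_p -> 'rV[R]_q :=
  foldr (fun i g => iter (alpha i) (partial i) g) f (enum 'I_p).

(* The value at X depends only on f near the scalar part of X, so a function
   on an open subset U of R^p is represented by any total extension of it.
   Every multi-index of length at most N has all its entries at most N. *)
Definition weil_prolongation (R : realType) (A : weilAlgType R) p q
    (f : 'rV[R]_p -> 'rV[R]_q) (X : 'rV[A]_p) : 'rV[A]_q :=
  let N := weil_index A in
  let x := map_mx (@scalar_part R A) X in
  let H := X - map_mx (in_alg A) x in
  \row_j \sum_(alpha : {ffun 'I_p -> 'I_N.+1} | (\sum_i alpha i <= N)%N)
     (((\prod_i (alpha i)`!)%:R)^-1 * mpartial (fun i => alpha i : nat) f x 0 j)
       *: \prod_i H 0 i ^+ alpha i.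

Definition weil_prolongation1 (R : realType) (A : weilAlgType R)
    (f : R -> R) (s : A) : A :=
  weil_prolongation (fun x : 'rV[R]_1 => const_mx (f (x 0 0)) : 'rV[R]_1)
    (const_mx s) 0 0.

(* M_(m, n)(R) is identified with R^(m * n) by mxvec. *)
Definition weil_prolongation_mx (R : realType) (A : weilAlgType R) m n
    (F : 'M[R]_(m, n) -> 'M[R]_(m, n)) (X : 'M[A]_(m, n)) : 'M[A]_(m, n) :=
  vec_mx (weil_prolongation (fun v => mxvec (F (vec_mx v))) (mxvec X)).

Definition mexp (R : realType) n (M : 'M[R]_n.+1) : 'M[R]_n.+1 :=
  limn (series (fun k => k`!%:R^-1 *: M ^+ k)).

Definition Exp (R : realType) (A : weilAlgType R) :
    'M[A]_3 -> 'M[A]_3 :=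
  weil_prolongation_mx (@mexp R 2).

Definition in_so3 (A : comNzRingType) (B : 'M[A]_3) : Prop := B^T = - B.

Definition in_SO3 (A : comNzRingType) (Q : 'M[A]_3) : Prop :=
  Q^T *m Q = 1%:M /\ \det Q = 1.

(* The numeral 2 in 'I_3 denotes 1 + 1, the last index. *)
Definition cross_mx (A : comNzRingType) (phi : 'cV[A]_3) : 'M[A]_3 :=
  \matrix_(i, j)
    nth 0 (nth [::] [:: [::          0; - phi 2 0;   phi 1 0];
                        [::    phi 2 0;         0; - phi 0 0];
                        [::  - phi 1 0;   phi 0 0;         0]] i) j.

Definition sinh (R : realType) (x : R) : R := (expR x - expR (- x)) / 2.
Definition cosh (R : realType) (x : R) : R := (expR x + expR (- x)) / 2.

Definition rodrigues_a (R : realType) (s : R) : R :=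
  if 0 < s then sin (Num.sqrt s) / Num.sqrt s
  else if s == 0 then 1
  else sinh (Num.sqrt (- s)) / Num.sqrt (- s).

Definition rodrigues_b (R : realType) (s : R) : R :=
  if 0 < s then (1 - cos (Num.sqrt s)) / s
  else if s == 0 then 2^-1
  else (cosh (Num.sqrt (- s)) - 1) / (- s).

(* Main.v *)
Require Import Defs.
From HB Require Import structures.
From mathcomp Require Import all_boot all_order all_algebra falgebra.
From mathcomp Require Import all_classical all_reals all_analysis.
From mathcomp Require Import -(notations) mpoly.
From mathcomp Require ssrcomplements.
From mathcomp Require Import ring lra.

(* Idea. Call f a limit of polynomials P_n when P_n -> f pointwise and, for
   every r, the norms sum |coefficient| r^degree of the P_n are bounded. The
   second order Taylor remainder of the P_n is then uniformly small, so all the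
   partial derivatives of f are the limits of those of the P_n. As the Weil
   prolongation of a polynomial is its evaluation over A, that of f at X is the
   limit of the P_n(X) in the finite dimensional algebra A. Applied to the
   partial sums of exp, a and b, where B = [phi]_x satisfies B^3 = - S B, this
   gives Rodrigues' formula, and it carries the identities
     a(4s) = (1 - s b(s)) a(s),  2 b(4s) = a(s)^2,  a(s)^2 = b(s) (2 - s b(s))
   from R to A.
   A rotation Q over A comes from a unit quaternion (p0, p): the matrix
   4 (p0, p) (p0, p)^T is linear in Q, it has rank one, and one of its diagonal
   entries has a positive scalar part, hence a square root by Hensel's lemma.
   With p0 of nonnegative scalar part, Hensel's lemma also solves
   cos (sqrt T) = 1 - T b(T) = p0 with a(T) invertible, and phi = 2 p / a(T)
   has S = 4 T and Exp [phi]_x = Q. *)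

Set Implicit Arguments.
Unset Strict Implicit.
Unset Printing Implicit Defensive.

Import Order.TTheory GRing.Theory Num.Theory numFieldNormedType.Exports.

Local Open Scope ring_scope.

(** * Weighted coefficient norms of real polynomials *)

Section PolynomialNorm.
Variables (R : realType) (p : nat).
Implicit Types (P Q : mpoly p R) (m : multinom p) (r : R).

(** For [r >= 0] this weighted l1 norm is submultiplicative and dominates the values of [P] on the
    polydisc of radius [r]. *)
Definition mnorm r P : R := \sum_(m <- msupp P) `|mcoeff m P| * r ^+ mdeg m.

(** Summing over one finite type of multi-indices, independent of the support, allows termwise
    comparison of different polynomials. *)
Lemma mnormwE k r P : (msize P <= k)%N ->
  mnorm r P = \sum_(m : bmultinom p k) `|mcoeff m P| * r ^+ mdeg m.
Proof.
move=> le_Pk; set I : subFinType _ := bmultinom p k.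
rewrite /mnorm (ssrcomplements.big_mksub I) ?msupp_uniq //=; first last.
  by move=> x /msize_mdeg_lt /leq_trans; apply.
rewrite big_rmcond //= => j /memN_msupp_eq0 ->.
by rewrite normr0 mul0r.
Qed.

Lemma mnorm0 r : mnorm r 0 = 0.
Proof. by rewrite /mnorm msupp0 big_nil. Qed.

Lemma mnormX r m : mnorm r (mpolyX R m) = r ^+ mdeg m.
Proof. by rewrite /mnorm msuppX big_seq1 mcoeffX eqxx normr1 mul1r. Qed.

Lemma mnorm_ge0 r P : 0 <= r -> 0 <= mnorm r P.
Proof. by move=> r0; apply: sumr_ge0 => m _; rewrite mulr_ge0 ?exprn_ge0. Qed.

Lemma ler_mnormD r P Q : 0 <= r -> mnorm r (P + Q) <= mnorm r P + mnorm r Q.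
Proof.
move=> r0; pose k := maxn (msize (P + Q)) (maxn (msize P) (msize Q)).
rewrite !(@mnormwE k) ?leq_max ?leqnn ?orbT //.
rewrite -big_split; apply: ler_sum => m _ /=.
by rewrite -mulrDl ler_wpM2r ?exprn_ge0 // mcoeffD ler_normD.
Qed.

Lemma mnormZ r c P : mnorm r (c *: P) = `|c| * mnorm r P.
Proof.
pose k := maxn (msize (c *: P)) (msize P).
rewrite !(@mnormwE k) ?leq_max ?leqnn ?orbT // mulr_sumr.
by apply: eq_bigr => m _; rewrite mcoeffZ normrM mulrA.
Qed.

Lemma ler_mnorm_sum r (I : Type) (s : seq I) (F : I -> mpoly p R) :
  0 <= r -> mnorm r (\sum_(i <- s) F i) <= \sum_(i <- s) mnorm r (F i).
Proof.
move=> r0; elim: s => [|i s IH]; first by rewrite !big_nil mnorm0.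
by rewrite !big_cons (le_trans (ler_mnormD _ _ r0)) ?lerD2l.
Qed.

Lemma ler_mnormM r P Q : 0 <= r -> mnorm r (P * Q) <= mnorm r P * mnorm r Q.
Proof.
move=> r0; rewrite {1}(mpolyE P) {1}(mpolyE Q) mulr_suml.
apply: (le_trans (ler_mnorm_sum _ _ r0)).
rewrite /mnorm mulr_suml; apply: ler_sum => m _; rewrite mulr_sumr.
apply: (le_trans (ler_mnorm_sum _ _ r0)).
rewrite mulr_sumr; apply: ler_sum => m' _.
rewrite -scalerAl -scalerAr !mnormZ -mpolyXD mnormX mdegD exprD.
by rewrite mulrA mulrACA.
Qed.

(** By the triangle inequality a linear functional is controlled by its values on monomials;
    evaluation and the Taylor remainder are both bounded this way. *)
Lemma ler_norm_linear r c (L : mpoly p R -> R) P :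
  {morph L : P Q / P + Q} -> (forall a Q, L (a *: Q) = a * L Q) ->
  (forall m, `|L (mpolyX R m)| <= c * r ^+ mdeg m) -> `|L P| <= c * mnorm r P.
Proof.
move=> LD LZ Lb; have L0 : L 0 = 0 by rewrite -[X in L X](scale0r 0) LZ mul0r.
rewrite {1}(mpolyE P) (big_morph L LD L0).
apply: (le_trans (ler_norm_sum _ _ _)); rewrite mulr_sumr.
apply: ler_sum => m _; rewrite LZ normrM mulrCA.
by rewrite ler_wpM2l.
Qed.

(** Differentiating a monomial brings down an exponent at most [2 ^ mdeg m], which doubling the
    radius absorbs; the drop in degree is harmless as [1 <= r]. *)
Lemma mnorm_deriv r i P : 1 <= r -> mnorm r (mderiv i P) <= mnorm (2 * r) P.
Proof.
move=> r1; have r0 : 0 <= r by apply: le_trans r1.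
rewrite {1}(mpolyE P) linear_sum; apply: (le_trans (ler_mnorm_sum _ _ r0)).
apply: ler_sum => m _; rewrite linearZ /= mderivX !mnormZ mnormX.
rewrite ler_wpM2l // ger0_norm // exprMn ler_pM ?exprn_ge0 //.
  rewrite -natrX ler_nat ltnW // (leq_ltn_trans _ (ltn_expl _ (leqnn 2))) //.
  by rewrite mdegE (bigD1 i) //= leq_addr.
by rewrite ler_weXn2l // mdegB.
Qed.

Lemma mulrn_expr_le (x : R) n : 0 <= x -> n%:R * x ^+ n.-1 <= (x + 1) ^+ n.
Proof.
move=> x0; elim: n => [|n IH]; first by rewrite mul0r exprn_ge0 // addr_ge0.
rewrite -addn1 natrD mulrDl mul1r addn1 /= [in leRHS]exprS mulrDl mul1r.
rewrite lerD //; last by rewrite lerXn2r ?nnegrE ?addr_ge0 ?lerDl.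
case: n IH => [|n] IH; first by rewrite mul0r mulr1.
by rewrite [x ^+ n.+1]exprS mulrCA ler_wpM2l.
Qed.

(** The remainder at [n + 1] is [y + t] times the remainder at [n], plus [t ^ 2 * n * y ^ n.-1]. The
    factor costs [|y| + 1] and the added term at most one more [t ^ 2 * r ^ n], whence the margin 2
    in [r]. *)
Lemma expr_taylor2 (y t r : R) n : `|t| <= 1 -> `|y| + 2 <= r ->
  `|(y + t) ^+ n - y ^+ n - t * (n%:R * y ^+ n.-1)| <= t ^+ 2 * r ^+ n.
Proof.
move=> t1 ry; have y0 := normr_ge0 y.
have yt : `|y + t| <= `|y| + 1 by rewrite (le_trans (ler_normD _ _)) ?lerD2l.
have r1 : `|y| + 1 <= r by lra.
elim: n => [|n IH].
  by rewrite !expr0 mul0r mulr0 subrr subr0 normr0 mulr1 sqr_ge0.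
have -> : (y + t) ^+ n.+1 - y ^+ n.+1 - t * (n.+1%:R * y ^+ n) =
  (y + t) * ((y + t) ^+ n - y ^+ n - t * (n%:R * y ^+ n.-1)) +
    t ^+ 2 * (n%:R * y ^+ n.-1).
  case: n {IH} => [|n] /=; first by rewrite expr1 expr0; ring.
  by rewrite !exprS -[n.+2%:R]natr1 -[n.+1%:R]natr1; ring.
apply: (le_trans (ler_normD _ _));
rewrite [`|(y + t) * _|]normrM [`|t ^+ 2 * _|]normrM [`|n%:R * _|]normrM.
rewrite [`|t ^+ 2|]ger0_norm ?sqr_ge0 //.
have b1 : `|n%:R| * `|y ^+ n.-1| <= r ^+ n.
  rewrite normrX normr_nat; apply: (le_trans (mulrn_expr_le n y0)).
  by rewrite lerXn2r // nnegrE; lra.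
have t2 := sqr_ge0 t.
apply: (le_trans (lerD (ler_pM _ _ yt IH) (ler_wpM2l t2 b1))) => //.
rewrite mulrCA -mulrDr ler_wpM2l // -[X in _ + X]mul1r -mulrDl exprS.
by rewrite ler_wpM2r ?exprn_ge0; lra.
Qed.

End PolynomialNorm.

(** * Bounds on values and second order remainders of polynomials *)

Section PolynomialEvaluation.
Variables (R : realType) (p : nat).
Implicit Types (P Q : mpoly p R) (m : multinom p) (r : R) (x : 'rV[R]_p).

Lemma row_delta x t i j :
  (x + t *: delta_mx 0 i) 0 j = if j == i then x 0 j + t else x 0 j.
Proof.
by rewrite !mxE eqxx /=; case: eqP => _; rewrite ?mulr1 ?mulr0 ?addr0.
Qed.

Lemma ler_norm_meval r x P : (forall i, `|x 0 i| <= r) ->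
  `|meval (x 0) P| <= mnorm r P.
Proof.
move=> xr; rewrite -[leRHS]mul1r.
apply: (@ler_norm_linear _ _ _ _ (meval (x 0))) => [|a Q|m].
- exact: mevalD.
- exact: mevalZ.
rewrite mevalX normr_prod mul1r mdegE -prodrXr ler_prod // => i _.
by rewrite normr_ge0 normrX lerXn2r // nnegrE (le_trans (normr_ge0 _) (xr i)).
Qed.

(** On a monomial only the factor in variable [i] changes, so the remainder is the one-variable
    remainder times the product [M] of the other factors. *)
Lemma meval_taylor2 r x (t : R) i P : (forall i, `|x 0 i| + 2 <= r) -> `|t| <= 1 ->
  `|meval ((x + t *: delta_mx 0 i) 0) P - meval (x 0) P
     - t * meval (x 0) (mderiv i P)| <= t ^+ 2 * mnorm r P.
Proof.
move=> xr t1.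
pose L P := meval ((x + t *: delta_mx 0 i) 0) P - meval (x 0) P
     - t * meval (x 0) (mderiv i P).
apply: (@ler_norm_linear _ _ _ _ L) => [P1 P2|a Q|m].
- by rewrite /L !(mevalD, mderivD); ring.
- by rewrite /L !(mevalZ, mderivZ); ring.
rewrite /L mderivX mevalZ !mevalX (bigD1 i) //= [X in _ - X - _](bigD1 i) //=.
rewrite [X in _ * (_ * X)](bigD1 i) //=.
rewrite row_delta eqxx.
have e1 : \prod_(j < p | j != i) (x + t *: delta_mx 0 i) 0 j ^+ m j =
          \prod_(j < p | j != i) x 0 j ^+ m j.
  by apply: eq_bigr => j /negbTE ji; rewrite row_delta ji.
have e2 : \prod_(j < p | j != i) x 0 j ^+ (mnm_sub m (mnm1 i)) j =
          \prod_(j < p | j != i) x 0 j ^+ m j.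
  apply: eq_bigr => j /negbTE ji.
  by rewrite mnmBE mnm1E eq_sym ji subn0.
rewrite e1 e2 mnmBE mnm1E eqxx subn1.
set M := \prod_(j < p | _) _.
have -> : (x 0 i + t) ^+ m i * M - x 0 i ^+ m i * M -
  t * ((m i)%:R * (x 0 i ^+ (m i).-1 * M)) =
  M * ((x 0 i + t) ^+ m i - x 0 i ^+ m i - t * ((m i)%:R * x 0 i ^+ (m i).-1)).
  by ring.
rewrite mdegE -prodrXr (bigD1 i) //= [leRHS]mulrA [leRHS]mulrC normrM.
apply: ler_pM => //; last by rewrite expr_taylor2.
rewrite /M normr_prod ler_prod // => j _.
rewrite normr_ge0 normrX lerXn2r // ?nnegrE //.
  by have := xr j; have := normr_ge0 (x 0 j); lra.
by have := xr j; lra.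
Qed.

End PolynomialEvaluation.

(** * Limits of polynomials with bounded norms, and their derivatives *)

Section EntireLimits.
Variables (R : realType) (p : nat).
Implicit Types (Ps : nat -> mpoly p R) (f : 'rV[R]_p -> R) (x : 'rV[R]_p).

Definition mnorm_bounded Ps :=
  forall r : R, 1 <= r -> exists C, forall n, mnorm r (Ps n) <= C.

Definition entire_limit Ps f :=
  mnorm_bounded Ps /\
  forall x, ((fun n => meval (x 0) (Ps n)) @ \oo --> f x)%classic.

(** Since [C] is independent of [n], the difference quotients approach the derivatives uniformly in
    [n], so that the limits in [t] and in [n] can be exchanged. *)
Lemma difference_quotient_bound Ps x i : mnorm_bounded Ps ->
  exists2 C, 0 <= C & forall n (t : R), t != 0 -> `|t| <= 1 ->
  `|t^-1 * (meval ((x + t *: delta_mx 0 i) 0) (Ps n) - meval (x 0) (Ps n)) -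
    meval (x 0) (mderiv i (Ps n))| <= `|t| * C.
Proof.
pose r := \sum_j `|x 0 j| + 2.
have xr j : `|x 0 j| + 2 <= r.
  by rewrite lerD2r (bigD1 j) //= lerDl sumr_ge0.
have r1 : 1 <= r.
  have : 0 <= \sum_j `|x 0 j| by rewrite sumr_ge0.
  by rewrite /r; lra.
case/(_ r r1) => C PC; exists C.
  by apply: le_trans (PC 0%N); rewrite mnorm_ge0 // (le_trans ler01).
move=> n t t0 t1.
have := meval_taylor2 i (Ps n) xr t1; set u := meval _ _; set v := meval _ _.
set w := meval _ _ => uvw.
have -> : t^-1 * (u - v) - w = t^-1 * (u - v - t * w).
  by rewrite [in RHS]mulrBr [t^-1 * (t * _)]mulKf.
rewrite normrM normfV mulrC ler_pdivrMr ?normr_gt0 //.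
apply: (le_trans uvw).
rewrite [leRHS]mulrAC -[`|t| * `|t|]expr2 real_normK ?num_real //.
by rewrite ler_wpM2l ?sqr_ge0.
Qed.

Lemma entire_limit_derivable Ps f x i : entire_limit Ps f ->
  derivable f x (delta_mx 0 i) /\
  ((fun n => meval (x 0) (mderiv i (Ps n))) @ \oo
     --> 'D_(delta_mx 0 i) f x)%classic.
Proof.
move=> [Pb Pf]; have [C C0 PC] := difference_quotient_bound x i Pb.
pose u n := meval (x 0) (mderiv i (Ps n)).
pose q t := t^-1 * (f (x + t *: delta_mx 0 i) - f x).
pose qn n t := t^-1 *
  (meval ((x + t *: delta_mx 0 i) 0) (Ps n) - meval (x 0) (Ps n)).
have qnq t : (qn ^~ t @ \oo --> q t)%classic.
  by exact: cvgM (cvg_cst _) (cvgB (Pf _) (Pf _)).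
(* Cauchy property: for one small [t], every [u n] stays within [t * C] of the term [qn n t] of a
   convergent sequence. *)
have cu : cvgn u.
  apply/cauchy_cvgP/cauchy_exP => e e0.
  (* The bound 1 admits the uniform estimate, the second one makes [t * C] at most [e / 2], and
     [C + 1] avoids a zero denominator when [C = 0]. *)
  pose t := Num.min 1 (e / (2 * (C + 1))).
  have t0 : 0 < t by rewrite lt_min ltr01 divr_gt0 // mulr_gt0 // ltr_wpDl.
  have t1 : t <= 1 by rewrite ge_min lexx.
  have tC : t * C <= e / 2.
    have : t <= e / (2 * (C + 1)) by rewrite ge_min lexx orbT.
    rewrite ler_pdivlMr; last by rewrite mulr_gt0 // ltr_wpDl.
    by nra.
  exists (q t).
  have /cvgrPdist_lt /(_ (e / 2)) : (qn ^~ t @ \oo --> q t)%classic by [].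
  rewrite divr_gt0 // => /(_ isT); apply: filterS => n qd.
  rewrite /ball /=.
  have := PC n t; rewrite gt_eqF // gtr0_norm // => /(_ isT t1) cd.
  rewrite -/(u n) -/(qn n t) in cd.
  have -> : q t - u n = (q t - qn n t) + (qn n t - u n) by ring.
  by apply: (le_lt_trans (ler_normD _ _)); lra.
(* The uniform estimate survives the limit in [n], so [q t] tends to [limn u] as [t] tends to 0. *)
have qu t : t != 0 -> `|t| <= 1 -> `|q t - limn u| <= `|t| * C.
  move=> t0 t1.
  have : ((fun n => `|qn n t - u n|) @ \oo --> `|q t - limn u|)%classic.
    by apply: cvg_norm; apply: cvgB.
  move=> /cvgr_to_le; apply; near=> n; exact: PC.
have ql : ((fun h => h^-1 *: ((f \o shift x) (h *: delta_mx 0 i) - f x)) @ 0^'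
    --> limn u)%classic.
  apply/cvgrPdist_le => e e0.
  have eC : 0 < e / (C + 1) by rewrite divr_gt0 // ltr_wpDl.
  near=> t.
  have t0 : t != 0 by near: t; exact: nbhs_dnbhs_neq.
  have t1 : `|t| <= 1 by near: t; apply: dnbhs0_le.
  have te : `|t| <= e / (C + 1) by near: t; apply: dnbhs0_le.
  have := qu t t0 t1; rewrite distrC /q /= [in x + _]addrC => /le_trans; apply.
  move: te; rewrite ler_pdivlMr; last by rewrite ltr_wpDl.
  by apply: le_trans; rewrite ler_wpM2l // lerDl.
split; first by apply/cvg_ex; exists (limn u).
by have -> : 'D_(delta_mx 0 i) f x = limn u by apply: cvg_lim.
Unshelve. all: by end_near.
Qed.

Lemma entire_limit_partial Ps f i : entire_limit Ps f ->
  entire_limit (fun n => mderiv i (Ps n)) ('D_(delta_mx 0 i) f).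
Proof.
move=> Pf; split=> [r r1|x]; last by have [] := entire_limit_derivable x i Pf.
have r2 : 1 <= 2 * r by lra.
have [C PC] := Pf.1 _ r2; exists C => n.
by apply: le_trans (PC n); apply: mnorm_deriv.
Qed.

End EntireLimits.

(** * Scalar part and nilpotency in a Weil algebra *)

Section WeilAlgebraTheory.
Variables (R : realType) (A : weilAlgType R).
Local Notation m := (weil_max A).
Local Notation N := (weil_index A).
Implicit Types (x y h : A).

Lemma weil_maxM x h : h \in m -> x * h \in m.
Proof.
move=> hm; have [+ _ _] := @weil_max_maximal R A.
by move=> /subvP; apply; rewrite memv_mul // memvf.
Qed.

Lemma scalar_partD x y : scalar_part (x + y) = scalar_part x + scalar_part y.
Proof. by rewrite /scalar_part !linearD. Qed.

Lemma scalar_partN x : scalar_part (- x) = - scalar_part x.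
Proof. by rewrite /scalar_part !linearN. Qed.

Lemma scalar_partZ (r : R) x : scalar_part (r *: x) = r * scalar_part x.
Proof. by rewrite /scalar_part !linearZ. Qed.

Lemma scalar_part_alg (r : R) : scalar_part (r%:A : A) = r.
Proof. by rewrite -[r%:A]addr0 scalar_part_unique ?mem0v. Qed.

Lemma scalar_part1 : scalar_part (1 : A) = 1.
Proof. by rewrite -(scale1r 1) scalar_part_alg. Qed.

(** The product differs from the product of the scalar parts by an element of the maximal ideal. *)
Lemma scalar_partM x y : scalar_part (x * y) = scalar_part x * scalar_part y.
Proof.
have xm := scalar_part_max x; have ym := scalar_part_max y.
set r := scalar_part x in xm *; set s := scalar_part y in ym *.
have -> : x * y = (r * s)%:A + (x * (y - s%:A) + s *: (x - r%:A)).
  have xs : x * s%:A = s *: x by rewrite mulr_algr.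
  have sx : s *: (x - r%:A) = s *: x - (r * s)%:A.
    by rewrite scalerBr scalerA [s * r]mulrC.
  by rewrite mulrBr xs sx; ring.
by rewrite scalar_part_unique // rpredD ?rpredZ ?weil_maxM.
Qed.

Lemma scalar_part_eq0 h : (scalar_part h == 0) = (h \in m).
Proof.
apply/eqP/idP => [h0|hm]; last by rewrite -[h]add0r -(scale0r 1) scalar_part_unique.
by have := scalar_part_max h; rewrite h0 scale0r subr0.
Qed.

Lemma weil_maxX k h : h \in m -> h ^+ k \in (m ^+ k)%VS.
Proof.
move=> hm; elim: k => [|k IH]; first by rewrite expr0 expv0 memv_line.
by rewrite exprS expvSl memv_mul.
Qed.

Lemma weil_max_prod (I : Type) (s : seq I) (H : I -> A) (a : I -> nat) :
  (forall i, H i \in m) ->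
  \prod_(i <- s) H i ^+ a i \in (m ^+ (\sum_(i <- s) a i)%N)%VS.
Proof.
move=> Hm; elim: s => [|i s IH]; first by rewrite !big_nil expv0 memv_line.
by rewrite !big_cons expvD memv_mul // weil_maxX.
Qed.

Lemma weil_max_nilpotent k : (N < k)%N -> (m ^+ k)%VS = 0%VS.
Proof.
by move=> Nk; rewrite -(subnKC Nk) expvD weil_nilpotent prod0v.
Qed.

Lemma weil_nilpotentX k h : h \in m -> (N < k)%N -> h ^+ k = 0.
Proof.
move=> hm /weil_max_nilpotent mk; apply/eqP.
by rewrite -memv0 -mk weil_maxX.
Qed.

(** Cutting the binomial sum at the nilpotency index loses nothing, since higher powers of [h]
    vanish; terms with [k > n] have zero binomial coefficient. *)
Lemma binomial_truncated (x : R) h n : h \in m ->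
  \sum_(k < N.+1) ('C(n, k)%:R * x ^+ (n - k)) *: h ^+ k = (x%:A + h) ^+ n.
Proof.
move=> hm; rewrite exprDn.
pose F k := ('C(n, k)%:R * x ^+ (n - k)) *: h ^+ k.
rewrite (big_ord_widen (maxn N n).+1 F) ?ltnS ?leq_maxl // big_mkcond /=.
rewrite (big_ord_widen (maxn N n).+1
  (fun k => (x%:A ^+ (n - k) * h ^+ k) *+ 'C(n, k))) ?ltnS ?leq_maxr //.
rewrite [RHS]big_mkcond /=; apply: eq_bigr => k _; rewrite !ltnS.
have -> : (x%:A : A) ^+ (n - k) * h ^+ k *+ 'C(n, k) = F k.
  by rewrite -(rmorphXn (in_alg A)) /= mulr_algl -scaler_nat scalerA.
case: leqP => [kN|Nk]; case: leqP => // nk.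
- by rewrite /F bin_small // mul0r scale0r.
- by rewrite /F weil_nilpotentX // scaler0.
Qed.

End WeilAlgebraTheory.

(** * Coordinatewise limits in a Weil algebra *)

Section WeilLimits.
Variables (R : realType) (A : weilAlgType R).
Implicit Types (u v : nat -> A) (x y : A).

(** Coordinates in one basis describe the usual topology of the finite-dimensional real space
    [A]. *)
Definition cvgA u x := forall i,
  ((fun n => coord (vbasis {:A}) i (u n)) @ \oo --> coord (vbasis {:A}) i x)%classic.

Lemma cvgA_unique u x y : cvgA u x -> cvgA u y -> x = y.
Proof.
move=> ux uy; rewrite (coord_vbasis (memvf x)) (coord_vbasis (memvf y)).
by apply: eq_bigr => i _; rewrite (cvg_unique _ (ux i) (uy i)).
Qed.

Lemma cvgA_cst x : cvgA (fun=> x) x.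
Proof. by move=> i; apply: cvg_cst. Qed.

Lemma cvgAD u v x y : cvgA u x -> cvgA v y -> cvgA (fun n => u n + v n) (x + y).
Proof.
move=> ux vy i; under eq_fun do rewrite linearD.
by rewrite linearD; exact: cvgD (ux i) (vy i).
Qed.

Lemma cvgAZ (a : nat -> R) (r : R) x : (a @ \oo --> r)%classic ->
  cvgA (fun n => a n *: x) (r *: x).
Proof.
move=> ar i; rewrite linearZ; under eq_fun do rewrite linearZ.
exact: cvgM ar (cvg_cst _).
Qed.

Lemma cvgA_sum (I : Type) (s : seq I) (P : pred I) (u : I -> nat -> A) (x : I -> A) :
  (forall i, cvgA (u i) (x i)) ->
  cvgA (fun n => \sum_(i <- s | P i) u i n) (\sum_(i <- s | P i) x i).
Proof.
move=> ux; elim: s => [|i s IH].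
  under eq_fun do rewrite big_nil.
  by rewrite big_nil; apply: cvgA_cst.
under eq_fun do rewrite big_cons.
by rewrite big_cons; case: (P i) => //; apply: cvgAD.
Qed.

Lemma cvgAM u v x y : cvgA u x -> cvgA v y -> cvgA (fun n => u n * v n) (x * y).
Proof.
move=> ux vy; pose e := vbasis {:A}.
(* By bilinearity, a product is a finite combination of fixed products of basis vectors, whose
   coefficients are products of real coordinates. *)
have E a b : a * b = \sum_i \sum_j (coord e i a * coord e j b) *: (e`_i * e`_j).
  rewrite {1}(coord_vbasis (memvf a)) {1}(coord_vbasis (memvf b)) mulr_suml.
  apply: eq_bigr => i _; rewrite mulr_sumr; apply: eq_bigr => j _.
  by rewrite -scalerAl -scalerAr scalerA.
under eq_fun do rewrite E.
rewrite E; apply: cvgA_sum => i; apply: cvgA_sum => j; apply: cvgAZ.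
exact: cvgM (ux i) (vy j).
Qed.

Lemma cvgA_subseq u x (s : nat -> nat) : {homo s : m n / (m < n)%N} ->
  cvgA u x -> cvgA (u \o s) x.
Proof.
move=> s_mono ux i; apply: (cvg_comp s _ _ (ux i)).
apply/cvgnyPge => M; exists M => // n /= Mn; apply: leq_trans Mn _.
by elim: n => // n IH; apply: leq_ltn_trans IH _; apply: s_mono.
Qed.

End WeilLimits.

(** * Weil prolongations as limits of polynomial evaluations *)

Section Prolongation.
Variables (R : realType) (A : weilAlgType R) (p : nat).
Local Notation N := (weil_index A).

Lemma entire_limit_iter_partial q (Ps : 'I_q -> nat -> mpoly p R)
    (F : 'rV[R]_p -> 'rV[R]_q) i k :
  (forall j, entire_limit (Ps j) (fun x => F x 0 j)) ->
  forall j, entire_limit (fun n => iter k (mderiv i) (Ps j n))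
    (fun x => iter k (partial i) F x 0 j).
Proof.
move=> PF; elim: k => [|k IH] //= j.
(* The derivative of a row-valued map is taken componentwise once derivability is known, which the
   induction hypothesis provides. *)
have -> : (fun x => partial i (iter k (partial i) F) x 0 j) =
    'D_(delta_mx 0 i) (fun x => iter k (partial i) F x 0 j).
  apply/funext => x; rewrite /partial derive_mx ?mxE //.
  apply/derivable_mxP => a b; rewrite ord1.
  by have [] := entire_limit_derivable x i (IH b).
exact: entire_limit_partial (IH j).
Qed.

(** This unfolds the iterated derivative of a polynomial in the order of variables used by
    [mpartial]. *)
Lemma mderivm_iter (alpha : 'I_p -> nat) (P : mpoly p R) :
  mderivm (Multinom [tuple alpha i | i < p]) P =
  foldr (fun i => iter (alpha i) (mderiv i)) P (enum 'I_p).
Proof.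
rewrite [X in mderivm X](multinomUE_id) -big_enum mderiv_summ filter_predT.
elim: (enum 'I_p) => //= i s IH; rewrite mderivn_iter mnmE.
by congr (iter _ _ _); rewrite -IH.
Qed.

Lemma entire_limit_mpartial q (Ps : 'I_q -> nat -> mpoly p R)
    (F : 'rV[R]_p -> 'rV[R]_q) (alpha : 'I_p -> nat) :
  (forall j, entire_limit (Ps j) (fun x => F x 0 j)) ->
  forall j, entire_limit
    (fun n => mderivm (Multinom [tuple alpha i | i < p]) (Ps j n))
    (fun x => mpartial alpha F x 0 j).
Proof.
move=> PF j; under eq_fun do rewrite mderivm_iter.
rewrite /mpartial; elim: (enum 'I_p) j => [|i s IH] j //=.
exact: (@entire_limit_iter_partial _ (fun j n =>
  foldr (fun i => iter (alpha i) (mderiv i)) (Ps j n) s)).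
Qed.

(* Taylor's formula is exact on polynomials. *)
Lemma mmap_taylor (P : mpoly p R) (X : 'rV[A]_p)
    (x := map_mx (@scalar_part R A) X) (H := X - map_mx (in_alg A) x) :
  \sum_(alpha : {ffun 'I_p -> 'I_N.+1} | (\sum_i alpha i <= N)%N)
     (((\prod_i (alpha i)`!)%:R)^-1 *
       meval (x 0) (mderivm (Multinom [tuple alpha i : nat | i < p]) P))
       *: \prod_i H 0 i ^+ alpha i = mmap (in_alg A) (X 0) P.
Proof.
have Hm i : H 0 i \in weil_max A by rewrite !mxE scalar_part_max.
rewrite {1}[P]mpolyE /mmap.
under eq_bigr => alpha _.
  rewrite !linear_sum /= mulr_sumr scaler_suml.
  over.
rewrite exchange_big /=; apply: eq_bigr => k _.
rewrite /mmap1 mulr_algl.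
(* Multi-indices of length above [N] contribute zero, their product of powers of [H] lying in a
   vanishing power of the ideal. The unrestricted sum then factors over the variables. *)
transitivity (mcoeff k P *: \sum_(alpha : {ffun 'I_p -> 'I_N.+1})
   \prod_i (('C(k i, alpha i)%:R * x 0 i ^+ (k i - alpha i)) *: H 0 i ^+ alpha i)).
  rewrite scaler_sumr [RHS](bigID (fun alpha : {ffun 'I_p -> 'I_N.+1} =>
    \sum_i alpha i <= N)%N) /= [X in _ + X]big1 ?addr0 => [|alpha]; last first.
    rewrite -ltnNge => Na; rewrite scaler_prod.
    have := weil_max_prod (index_enum 'I_p) (fun i => alpha i : nat) Hm.
    by rewrite weil_max_nilpotent // memv0 => /eqP ->; rewrite !scaler0.
  apply: eq_bigr => alpha _; rewrite scaler_prod scalerA; congr (_ *: _).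
  rewrite linearZ /= mderivmX !mevalZ mevalX mulrCA; congr (_ * _).
  rewrite big_split /= mulrA; congr (_ * _); last first.
    by apply: eq_bigr => i _; rewrite mnmBE mnmE.
  (* In each variable the falling factorial from the derivative, divided by [alpha i] factorial, is
     a binomial coefficient. *)
  rewrite !natr_prod -prodfV -big_split; apply: eq_bigr => i _ /=.
  by rewrite mnmE -bin_ffact natrM mulrC mulfK // pnatr_eq0 -lt0n fact_gt0.
rewrite -(bigA_distr_bigA (fun i (a : 'I_N.+1) =>
  ('C(k i, a)%:R * x 0 i ^+ (k i - a)) *: H 0 i ^+ a)).
congr (_ *: _); apply: eq_bigr => i _.
by rewrite binomial_truncated // /H /x !mxE /=; congr (_ ^+ _); ring.
Qed.

(** The prolongation is a finite combination of partial derivatives with fixed coefficients in [A],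
    so it inherits their convergence; [mmap_taylor] recognises the approximants. *)
Theorem weil_prolongation_limit q (Ps : 'I_q -> nat -> mpoly p R)
    (F : 'rV[R]_p -> 'rV[R]_q) (X : 'rV[A]_p) j :
  (forall j, entire_limit (Ps j) (fun x => F x 0 j)) ->
  cvgA (fun n => mmap (in_alg A) (X 0) (Ps j n)) (weil_prolongation F X 0 j).
Proof.
move=> PF; under eq_fun do rewrite -mmap_taylor.
rewrite mxE; apply: cvgA_sum => alpha; apply: cvgAZ.
exact: cvgM (cvg_cst _) ((entire_limit_mpartial _ PF j).2 _).
Qed.

End Prolongation.

(** * The matrix exponential as a limit of polynomials *)

Lemma exp_partial_sum_le (R : realType) (x : R) n : 0 <= x ->
  \sum_(k < n) k`!%:R^-1 * x ^+ k <= expR x.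
Proof.
move=> x0; have -> : \sum_(k < n) k`!%:R^-1 * x ^+ k = series (exp_coeff x) n.
  by rewrite seriesEord; apply: eq_bigr => k _; rewrite /exp_coeff /= mulrC.
apply: nondecreasing_cvgn_le; last exact: is_cvg_series_exp_coeff.
by apply: nondecreasing_series => k _ _; apply: exp_coeff_ge0.
Qed.

Lemma cvg_mx (R : realType) m n (u : nat -> 'M[R]_(m, n)) (l : 'M[R]_(m, n)) :
  (forall i j, ((fun k => u k i j) @ \oo --> l i j)%classic) ->
  (u @ \oo --> l)%classic.
Proof.
move=> ul; apply/cvgrPdist_le => /= e e0; near=> x.
rewrite /Num.Def.normr/= mx_normrE (bigmax_le _ (ltW e0))//= => i _.
rewrite !mxE/=.
move: i; near: x; apply: filter_forall => /= i.
exact: ((cvgrPdist_le _ _).1 (ul i.1 i.2)).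
Unshelve. all: by end_near. Qed.

Section MatrixExponential.
Variables (R : realType) (n : nat).
Local Notation p := (n.+1 * n.+1)%N.

(** The entries are independent indeterminates, so the powers of this matrix express the entries of
    any [M ^+ k] as polynomials in those of [M]. *)
Definition generic_mx : 'M[mpoly p R]_n.+1 :=
  \matrix_(i, j) mpolyX R (mnm1 (mxvec_index i j)).

(** Each multiplication by the generic matrix sums [n.+1] products with an indeterminate, of norm
    [r]. *)
Lemma mnorm_generic_mxX r k i j : 0 <= r ->
  mnorm r ((generic_mx ^+ k) i j) <= (n.+1%:R * r) ^+ k.
Proof.
move=> r0; elim: k i j => [|k IH] i j.
  rewrite expr0 mxE; case: (i == j); last by rewrite mnorm0.
  by rewrite -mpolyX0 mnormX mdeg0.
rewrite exprS mxE; apply: (le_trans (ler_mnorm_sum _ _ r0)).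
rewrite exprS -mulrA mulr_natl -[X in _ *+ X](card_ord n.+1) -sumr_const.
apply: ler_sum => l _; apply: (le_trans (ler_mnormM _ _ r0)).
rewrite mxE mnormX mdeg1 expr1; exact: ler_wpM2l.
Qed.

(** The target ring is left general to serve both real evaluation and evaluation over [A]. *)
Lemma generic_mxX_eval (S : comNzRingType) (phi : {rmorphism mpoly p R -> S})
    (X : 'rV[S]_p) k i j :
  (forall l, phi (mpolyX R (mnm1 l)) = X 0 l) ->
  phi ((generic_mx ^+ k) i j) = (vec_mx X ^+ k) i j.
Proof.
move=> phiX; have -> : vec_mx X = map_mx phi generic_mx.
  by apply/matrixP => a b; rewrite !mxE phiX.
by rewrite -(rmorphXn (map_mx phi)) mxE.
Qed.

Definition exp_sum k i j : mpoly p R :=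
  \sum_(l < k) l`!%:R^-1 *: (generic_mx ^+ l) i j.

Lemma mnorm_exp_sum i j : mnorm_bounded (fun k => exp_sum k i j).
Proof.
move=> r r1; have r0 : 0 <= r by apply: le_trans r1.
exists (expR (n.+1%:R * r)) => k.
apply: (le_trans (ler_mnorm_sum _ _ r0)).
apply: le_trans (exp_partial_sum_le k _); last by rewrite mulr_ge0.
apply: ler_sum => l _; rewrite mnormZ ger0_norm ?invr_ge0 //.
by rewrite ler_wpM2l ?invr_ge0 // mnorm_generic_mxX.
Qed.

(** The value of [limn] in [mexp] is meaningful once convergence is known; comparison with a scalar
    exponential series provides it entry by entry. *)
Lemma cvg_mexp (M : 'M[R]_n.+1) i j :
  ((fun k => \sum_(l < k) l`!%:R^-1 * (M ^+ l) i j) @ \oo --> mexp M i j)%classic.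
Proof.
pose u l a b := l`!%:R^-1 * (M ^+ l) a b.
(* The sum bounds every entry of [M], and the factor [n.+1] is the one in the norm bound for powers
   of the generic matrix. *)
pose r := n.+1%:R * (\sum_a \sum_b `|M a b|).
have ub l a b : `|u l a b| <= exp_coeff r l.
  rewrite /u normrM ger0_norm ?invr_ge0 // /exp_coeff /= mulrC.
  rewrite ler_wpM2r ?invr_ge0 //.
  have := @generic_mxX_eval _ (meval (mxvec M 0)) (mxvec M) l a b.
  rewrite mxvecK => <-; last by move=> c /=; rewrite mevalXU.
  apply: le_trans (mnorm_generic_mxX _ _ _ _); last first.
    by apply: sumr_ge0 => c _; apply: sumr_ge0.
  apply: ler_norm_meval => c; case/mxvec_indexP: c => a' b'.
  rewrite mxvecE (bigD1 a') //= (bigD1 b') //= -addrA lerDl addr_ge0 //.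
    exact: sumr_ge0.
  by apply: sumr_ge0 => c _; apply: sumr_ge0.
have cu a b : cvgn (series (fun l => u l a b)).
  apply: normed_cvg; apply: series_le_cvg (is_cvg_series_exp_coeff r) => l //=.
  exact: le_trans (ub l a b).
have ul : (series (fun k => k`!%:R^-1 *: M ^+ k) @ \oo -->
    (\matrix_(a, b) limn (series (fun l => u l a b)) : 'M[R]_n.+1))%classic.
  apply: cvg_mx => a b; rewrite mxE.
  have -> : (fun k => series (fun k0 => k0`!%:R^-1 *: M ^+ k0) k a b) =
            series (fun l => u l a b).
    apply/funext => k; rewrite !seriesEord /= summxE.
    by apply: eq_bigr => l _; rewrite mxE.
  exact: cu.
rewrite /mexp (cvg_lim _ ul) // mxE.
have -> : (fun k => \sum_(l < k) l`!%:R^-1 * (M ^+ l) i j) =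
   series (fun l => u l i j) by rewrite seriesEord.
exact: cu.
Qed.

Lemma weil_prolongation_mexp (A : weilAlgType R) (X : 'M[A]_n.+1) i j :
  cvgA (fun k => \sum_(l < k) l`!%:R^-1 *: (X ^+ l) i j)
    (weil_prolongation_mx (@mexp R n) X i j).
Proof.
rewrite mxE.
pose Ps l k := mxvec (\matrix_(i, j) exp_sum k i j) 0 l.
have := @weil_prolongation_limit R A p p Ps (fun v => mxvec (mexp (vec_mx v)))
  (mxvec X) (mxvec_index i j).
have -> : (fun k => mmap (in_alg A) (mxvec X 0) (Ps (mxvec_index i j) k)) =
    (fun k => \sum_(l < k) l`!%:R^-1 *: (X ^+ l) i j).
  apply/funext => k; rewrite /Ps mxvecE mxE /exp_sum raddf_sum.
  apply: eq_bigr => l _ /=; rewrite mmapZ /= mulr_algl; congr (_ *: _).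
  have := @generic_mxX_eval _ (mmap (in_alg A) (mxvec X 0)) (mxvec X) l i j.
  by rewrite mxvecK; apply => c /=; rewrite mmapX mmap1U.
apply=> l; case/mxvec_indexP: l => a b; rewrite /Ps; split.
  under eq_fun do rewrite mxvecE mxE.
  exact: mnorm_exp_sum.
move=> x; rewrite mxvecE.
have -> : (fun k => meval (x 0) (mxvec (\matrix_(i, j) exp_sum k i j) 0
    (mxvec_index a b))) = (fun k => \sum_(l < k) l`!%:R^-1 * (vec_mx x ^+ l) a b).
  apply/funext => k; rewrite mxvecE mxE /exp_sum raddf_sum.
  apply: eq_bigr => l _; rewrite [LHS]mevalZ; congr (_ * _).
  by apply: (@generic_mxX_eval _ (meval (x 0))) => c /=; rewrite mevalXU.
exact: cvg_mexp.
Qed.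

End MatrixExponential.

(** * Identities and power series of the real functions a and b *)

Lemma eq_cvgn (R : realType) (u v : nat -> R) (l l' : R) : u =1 v -> l = l' ->
  (u @ \oo --> l)%classic -> (v @ \oo --> l')%classic.
Proof. by move=> /funext -> ->. Qed.

Section RodriguesFunctions.
Variable R : realType.
Implicit Types (s x : R).

Lemma rodrigues_a_sqr x : 0 < x -> rodrigues_a (x ^+ 2) = sin x / x.
Proof. by move=> x0; rewrite /rodrigues_a exprn_gt0 // sqrtr_sqr gtr0_norm. Qed.

Lemma rodrigues_b_sqr x : 0 < x -> rodrigues_b (x ^+ 2) = (1 - cos x) / x ^+ 2.
Proof. by move=> x0; rewrite /rodrigues_b exprn_gt0 // sqrtr_sqr gtr0_norm. Qed.

Lemma rodrigues_a0 : rodrigues_a 0 = 1 :> R.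
Proof. by rewrite /rodrigues_a ltxx eqxx. Qed.

Lemma rodrigues_b0 : rodrigues_b 0 = 2^-1 :> R.
Proof. by rewrite /rodrigues_b ltxx eqxx. Qed.

Lemma rodrigues_a_nsqr x : 0 < x -> rodrigues_a (- x ^+ 2) = sinh x / x.
Proof.
move=> x0; have x2 := exprn_gt0 2 x0.
rewrite /rodrigues_a oppr_gt0 ltNge ltW //= oppr_eq0 gt_eqF //= opprK.
by rewrite sqrtr_sqr gtr0_norm.
Qed.

Lemma rodrigues_b_nsqr x : 0 < x ->
  rodrigues_b (- x ^+ 2) = (cosh x - 1) / x ^+ 2.
Proof.
move=> x0; have x2 := exprn_gt0 2 x0.
rewrite /rodrigues_b oppr_gt0 ltNge ltW //= oppr_eq0 gt_eqF //= opprK.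
by rewrite sqrtr_sqr gtr0_norm.
Qed.

(** The three cases match those in the definitions of a and b and eliminate the square roots. *)
Lemma real_sqr_ind (P : R -> Prop) :
  P 0 -> (forall x, 0 < x -> P (x ^+ 2)) -> (forall x, 0 < x -> P (- x ^+ 2)) ->
  forall s, P s.
Proof.
move=> P0 Pp Pn s; have [s0|s0|->] // := ltgtP s 0.
  have := Pn (Num.sqrt (- s)); rewrite sqrtr_gt0 oppr_gt0 s0 sqr_sqrtr ?opprK.
    exact.
  by rewrite oppr_ge0 ltW.
have := Pp (Num.sqrt s); rewrite sqrtr_gt0 s0 sqr_sqrtr; first exact.
exact: ltW.
Qed.

Lemma sinh_mulr2 x : sinh (2 * x) = 2 * sinh x * cosh x.
Proof.
rewrite /sinh /cosh -mulrN !mulr_natl !mulr2n !expRD.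
by field.
Qed.

Lemma cosh_mulr2 x : cosh (2 * x) = 1 + 2 * sinh x ^+ 2.
Proof.
rewrite /sinh /cosh -mulrN !mulr_natl !mulr2n !expRD !expRN.
by field; rewrite gt_eqF ?expR_gt0.
Qed.

Lemma cosh2Bsinh2 x : cosh x ^+ 2 - sinh x ^+ 2 = 1.
Proof.
by rewrite /sinh /cosh !expRN; field; rewrite gt_eqF ?expR_gt0.
Qed.

(** For [s = x ^+ 2] this is sin 2x = 2 sin x cos x, because 1 - s b(s) = cos x; negative [s] gives
    the hyperbolic analogue. *)
Lemma rodrigues_a_mul4 s :
  rodrigues_a (4 * s) = (1 - s * rodrigues_b s) * rodrigues_a s.
Proof.
move: s; apply: real_sqr_ind => [|x x0|x x0].
- by rewrite mulr0 rodrigues_a0 mul0r subr0 mulr1.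
- have -> : 4 * x ^+ 2 = (2 * x) ^+ 2 by ring.
  rewrite !rodrigues_a_sqr ?mulr_gt0 // rodrigues_b_sqr // mulr_natl sin_mulr2n.
  by field; rewrite gt_eqF.
- have -> : 4 * (- x ^+ 2) = - (2 * x) ^+ 2 by ring.
  rewrite !rodrigues_a_nsqr ?mulr_gt0 // rodrigues_b_nsqr // sinh_mulr2.
  by field; rewrite gt_eqF.
Qed.

(** This is 1 - cos 2x = 2 sin^2 x, or cosh 2x - 1 = 2 sinh^2 x for negative [s]. *)
Lemma rodrigues_b_mul4 s : 2 * rodrigues_b (4 * s) = rodrigues_a s ^+ 2.
Proof.
move: s; apply: real_sqr_ind => [|x x0|x x0].
- by rewrite mulr0 rodrigues_a0 rodrigues_b0; field.
- have -> : 4 * x ^+ 2 = (2 * x) ^+ 2 by ring.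
  rewrite rodrigues_a_sqr // rodrigues_b_sqr ?mulr_gt0 //.
  rewrite [2 * x]mulr_natl cos_mulr2n.
  have := cos2Dsin2 x => cs.
  rewrite expr_div_n -[sin x ^+ 2](addKr (cos x ^+ 2)) cs.
  by field; rewrite gt_eqF.
- have -> : 4 * (- x ^+ 2) = - (2 * x) ^+ 2 by ring.
  rewrite rodrigues_a_nsqr // rodrigues_b_nsqr ?mulr_gt0 // cosh_mulr2.
  by field; rewrite gt_eqF.
Qed.

(** This is sin^2 x = (1 - cos x)(1 + cos x) divided by x^2, or its hyperbolic analogue. *)
Lemma rodrigues_a_sqrE s :
  rodrigues_a s ^+ 2 = rodrigues_b s * (2 - s * rodrigues_b s).
Proof.
move: s; apply: real_sqr_ind => [|x x0|x x0].
- by rewrite rodrigues_a0 rodrigues_b0; field.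
- rewrite rodrigues_a_sqr // rodrigues_b_sqr //.
  have := cos2Dsin2 x => cs.
  rewrite expr_div_n -[sin x ^+ 2](addKr (cos x ^+ 2)) cs.
  by field; rewrite gt_eqF.
- rewrite rodrigues_a_nsqr // rodrigues_b_nsqr //.
  have := cosh2Bsinh2 x => cs.
  rewrite expr_div_n -[sinh x ^+ 2](subKr (cosh x ^+ 2)) cs.
  by field; rewrite gt_eqF.
Qed.

Definition rodrigues_a_coef k : R := (-1) ^+ k / k.*2.+1`!%:R.
Definition rodrigues_b_coef k : R := (-1) ^+ k / k.*2.+2`!%:R.

(** Grouping the terms in pairs lets the even and odd halves be separated by adding or subtracting
    the series at [- x]. *)
Lemma expR_even_sum x :
  ((fun n => \sum_(k < n) (x ^+ k.*2 / k.*2`!%:R + x ^+ k.*2.+1 / k.*2.+1`!%:R))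
     @ \oo --> expR x)%classic.
Proof.
have -> : (fun n => \sum_(k < n) (x ^+ k.*2 / k.*2`!%:R +
     x ^+ k.*2.+1 / k.*2.+1`!%:R)) = series (exp_coeff x) \o double.
  apply/funext => n /=; elim: n => [|n IH].
    by rewrite big_ord0 seriesEord /= big_ord0.
  by rewrite big_ord_recr /= IH doubleS !seriesSr -addrA.
have cx : (series (exp_coeff x) @ \oo --> expR x)%classic.
  exact: is_cvg_series_exp_coeff.
apply: (cvg_comp double _ _ cx).
apply/cvgnyPge => M; exists M => // n /= Mn; apply: leq_trans Mn _.
by rewrite -addnn leq_addr.
Qed.

Lemma cvg_sinh x :
  ((fun n => \sum_(k < n) x ^+ k.*2.+1 / k.*2.+1`!%:R) @ \oo --> sinh x)%classic.
Proof.
apply: (eq_cvgn _ _ (cvgM (cvgB (@expR_even_sum x) (@expR_even_sum (- x)))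
  (cvg_cst (2^-1 : R)))) => // n; rewrite ?fctE /=.
rewrite -sumrB mulr_suml; apply: eq_bigr => k _.
rewrite !exprS -mul2n !exprM sqrrN.
by field; rewrite !pnatr_eq0 -!lt0n !fact_gt0.
Qed.

Lemma cvg_cosh x :
  ((fun n => \sum_(k < n) x ^+ k.*2 / k.*2`!%:R) @ \oo --> cosh x)%classic.
Proof.
apply: (eq_cvgn _ _ (cvgM (cvgD (@expR_even_sum x) (@expR_even_sum (- x)))
  (cvg_cst (2^-1 : R)))) => // n; rewrite ?fctE /=.
rewrite -big_split mulr_suml; apply: eq_bigr => k _ /=.
rewrite !exprS -mul2n !exprM sqrrN.
by field; rewrite !pnatr_eq0 -!lt0n !fact_gt0.
Qed.

Lemma cvg_rodrigues_a s :
  ((fun n => \sum_(k < n) rodrigues_a_coef k * s ^+ k) @ \oo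
     --> rodrigues_a s)%classic.
Proof.
move: s; apply: real_sqr_ind => [|x x0|x x0].
(* The shift discards the empty sum at [n = 0]; all later partial sums equal 1. *)
- rewrite rodrigues_a0 -(cvg_shiftS _).
  have -> : (fun n => \sum_(k < n.+1) rodrigues_a_coef k * 0 ^+ k) = fun=> 1.
    apply/funext => n; rewrite big_ord_recl big1 ?addr0 => [|k _].
      by rewrite /rodrigues_a_coef !expr0 divr1 mulr1.
    by rewrite expr0n mulr0.
  exact: cvg_cst.
- rewrite rodrigues_a_sqr //.
  apply: (eq_cvgn _ _ (cvgM (@cvg_sin_coeff' _ x) (cvg_cst (x^-1 : R)))) => // n /=.
  rewrite seriesEord /= mulr_suml; apply: eq_bigr => k _.
  rewrite /sin_coeff' /rodrigues_a_coef -exprM mul2n exprS -exprnP.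
  by field; rewrite pnatr_eq0 -lt0n fact_gt0 gt_eqF.
- rewrite rodrigues_a_nsqr //.
  apply: (eq_cvgn _ _ (cvgM (@cvg_sinh x) (cvg_cst (x^-1 : R)))) => // n /=.
  rewrite mulr_suml; apply: eq_bigr => k _.
  rewrite /rodrigues_a_coef [(- x ^+ 2) ^+ k]exprNn -exprM mul2n exprS.
  rewrite mulrACA -expr2 sqrr_sign mul1r.
  by field; rewrite pnatr_eq0 -lt0n fact_gt0 gt_eqF.
Qed.

(** Here [c] stands for the cosine or the hyperbolic cosine: its constant term cancels against 1 and
    division by [s] shifts the remaining coefficients. *)
Lemma cvg_rodrigues_b_aux s c : s != 0 ->
  ((fun n => \sum_(k < n) (- s) ^+ k / k.*2`!%:R) @ \oo --> c)%classic ->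
  ((fun n => \sum_(k < n) rodrigues_b_coef k * s ^+ k) @ \oo
     --> (1 - c) / s)%classic.
Proof.
move=> s0; rewrite -(cvg_shiftS _) => sc.
apply: (eq_cvgn _ _ (cvgM (cvgB (cvg_cst (1 : R)) sc)
  (cvg_cst (s^-1 : R)))) => // n; rewrite ?fctE /=.
rewrite big_ord_recl /= expr0 divr1 opprD addNKr -sumrN mulr_suml.
apply: eq_bigr => k _; rewrite /rodrigues_b_coef /= /bump /= add1n doubleS.
rewrite [(- s) ^+ _]exprNn !exprS.
by field; rewrite pnatr_eq0 -lt0n fact_gt0 s0.
Qed.

Lemma cvg_rodrigues_b s :
  ((fun n => \sum_(k < n) rodrigues_b_coef k * s ^+ k) @ \oo
     --> rodrigues_b s)%classic.
Proof.
move: s; apply: real_sqr_ind => [|x x0|x x0].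
- rewrite rodrigues_b0 -(cvg_shiftS _).
  have -> : (fun n => \sum_(k < n.+1) rodrigues_b_coef k * 0 ^+ k) = fun=> 2^-1.
    apply/funext => n; rewrite big_ord_recl big1 ?addr0 => [|k _].
      by rewrite /rodrigues_b_coef !expr0 mulr1 mul1r.
    by rewrite expr0n mulr0.
  exact: cvg_cst.
- rewrite rodrigues_b_sqr //; apply: cvg_rodrigues_b_aux.
    by rewrite gt_eqF ?exprn_gt0.
  apply: (eq_cvgn _ _ (@cvg_cos_coeff' _ x)) => // n /=.
  rewrite seriesEord /=; apply: eq_bigr => k _.
  by rewrite /cos_coeff' [(- x ^+ 2) ^+ k]exprNn -exprM mul2n.
- rewrite rodrigues_b_nsqr //.
  have -> : (cosh x - 1) / x ^+ 2 = (1 - cosh x) / (- x ^+ 2).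
    by field; rewrite gt_eqF.
  apply: cvg_rodrigues_b_aux; first by rewrite oppr_eq0 gt_eqF ?exprn_gt0.
  apply: (eq_cvgn _ _ (@cvg_cosh x)) => // n /=.
  by apply: eq_bigr => k _; rewrite opprK -exprM mul2n.
Qed.

End RodriguesFunctions.

(** * Differences and products of entire limits *)

Section EntireLimitAlgebra.
Variables (R : realType) (p : nat).
Implicit Types (Ps Qs : nat -> mpoly p R) (f g : 'rV[R]_p -> R).

Lemma entire_limit_cst (P : mpoly p R) :
  entire_limit (fun=> P) (fun x => meval (x 0) P).
Proof. by split=> [r _|x]; [exists (mnorm r P) | apply: cvg_cst]. Qed.

Lemma entire_limitB Ps Qs f g : entire_limit Ps f -> entire_limit Qs g ->
  entire_limit (fun n => Ps n - Qs n) (fun x => f x - g x).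
Proof.
move=> [Pb Pf] [Qb Qg]; split=> [r r1|x]; last first.
  by under eq_fun do rewrite mevalB; apply: cvgB.
have r0 : 0 <= r by apply: le_trans r1.
have [C PC] := Pb r r1; have [D QD] := Qb r r1; exists (C + D) => n.
apply: (le_trans (ler_mnormD _ _ r0)); apply: lerD => //.
by rewrite -scaleN1r mnormZ normrN1 mul1r.
Qed.

Lemma entire_limitM Ps Qs f g : entire_limit Ps f -> entire_limit Qs g ->
  entire_limit (fun n => Ps n * Qs n) (fun x => f x * g x).
Proof.
move=> [Pb Pf] [Qb Qg]; split=> [r r1|x]; last first.
  by under eq_fun do rewrite mevalM; apply: cvgM.
have r0 : 0 <= r by apply: le_trans r1.
have [C PC] := Pb r r1; have [D QD] := Qb r r1; exists (C * D) => n.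
by apply: (le_trans (ler_mnormM _ _ r0)); apply: ler_pM => //; apply: mnorm_ge0.
Qed.

End EntireLimitAlgebra.

(** * One-variable power series and their evaluation over a Weil algebra *)

Section PowerSeries.
Variable R : realType.
Implicit Types (c : nat -> R) (f : R -> R).

Definition varX : mpoly 1 R := mpolyX R (mnm1 ord0).

Definition power_sum c n : mpoly 1 R := \sum_(k < n) c k *: varX ^+ k.

Lemma mnorm_varXn r k : mnorm r (varX ^+ k) = r ^+ k.
Proof. by rewrite /varX mpolyXn mnormX mdegMn mdeg1 mul1n. Qed.

(** Factorial decay of the coefficients bounds the norms by exp(b r). The parameter [b] leaves room
    for a rescaled variable. *)
Lemma power_sum_bounded c (b : R) : 0 <= b ->
  (forall k, `|c k| <= b ^+ k / k`!%:R) -> mnorm_bounded (power_sum c).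
Proof.
move=> b0 cb r r1; have r0 : 0 <= r by apply: le_trans r1.
exists (expR (b * r)) => n.
apply: (le_trans (ler_mnorm_sum _ _ r0)).
apply: le_trans (exp_partial_sum_le n _); last by rewrite mulr_ge0.
apply: ler_sum => k _; rewrite mnormZ mnorm_varXn exprMn mulrA.
by rewrite ler_wpM2r ?exprn_ge0 // mulrC.
Qed.

Lemma meval_varX (x : 'rV[R]_1) : meval (x 0) varX = x 0 0.
Proof. by rewrite mevalXU. Qed.

Lemma meval_power_sum c n (x : 'rV[R]_1) :
  meval (x 0) (power_sum c n) = \sum_(k < n) c k * x 0 0 ^+ k.
Proof.
rewrite raddf_sum; apply: eq_bigr => k _.
by rewrite [LHS]mevalZ rmorphXn /= meval_varX.
Qed.

Lemma entire_power_sum c (b : R) f : 0 <= b ->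
  (forall k, `|c k| <= b ^+ k / k`!%:R) ->
  (forall s, ((fun n => \sum_(k < n) c k * s ^+ k) @ \oo --> f s)%classic) ->
  entire_limit (power_sum c) (fun x : 'rV[R]_1 => f (x 0 0)).
Proof.
move=> b0 cb cf; split; first exact: power_sum_bounded cb.
by move=> x; under eq_fun do rewrite meval_power_sum; exact: cf.
Qed.

Section OverWeilAlgebra.
Variable A : weilAlgType R.
Implicit Types s : A.

Definition eval_at s : mpoly 1 R -> A := mmap (in_alg A) (fun=> s).

HB.instance Definition _ s := GRing.RMorphism.copy (eval_at s)
  (mmap (in_alg A) (fun=> s)).

Lemma eval_at_varX s : eval_at s varX = s.
Proof. by rewrite /eval_at /varX mmapX mmap1U. Qed.

Lemma eval_at_power_sum s c n :
  eval_at s (power_sum c n) = \sum_(k < n) c k *: s ^+ k.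
Proof.
rewrite raddf_sum; apply: eq_bigr => k _ /=.
by rewrite [LHS]mmapZ -/(eval_at s (varX ^+ k)) rmorphXn /= eval_at_varX mulr_algl.
Qed.

Lemma weil_prolongation1_limit (Ps : nat -> mpoly 1 R) f s :
  entire_limit Ps (fun x : 'rV[R]_1 => f (x 0 0)) ->
  cvgA (fun n => eval_at s (Ps n)) (weil_prolongation1 f s).
Proof.
move=> Pf.
have -> : (fun n => eval_at s (Ps n)) =
    (fun n => mmap (in_alg A) ((const_mx s : 'rV[A]_1) 0) (Ps n)).
  by apply/funext => n; congr (mmap _ _ _); apply/funext => i; rewrite mxE.
apply: (@weil_prolongation_limit _ _ _ _ (fun=> Ps)) => j.
by under eq_fun do rewrite mxE.
Qed.

Lemma weil_prolongation1_unique (Ps : nat -> mpoly 1 R) f s y :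
  entire_limit Ps (fun x : 'rV[R]_1 => f (x 0 0)) ->
  cvgA (fun n => eval_at s (Ps n)) y -> weil_prolongation1 f s = y.
Proof. by move=> /weil_prolongation1_limit Pf; apply: cvgA_unique (Pf s). Qed.

(** In one variable a multi-index is a single exponent. The result is the polynomial in [h] to which
    Hensel's lemma is applied. *)
Lemma weil_prolongation1_taylor f (t : R) (h : A) : h \in weil_max A ->
  let F := fun x : 'rV[R]_1 => const_mx (f (x 0 0)) : 'rV[R]_1 in
  weil_prolongation1 f (t%:A + h) =
  \sum_(k < (weil_index A).+1)
    (k`!%:R^-1 * iter k (partial 0) F (const_mx t) 0 0) *: h ^+ k.
Proof.
move=> hm F; rewrite /weil_prolongation1 mxE.
have e1 : map_mx (@scalar_part R A) (const_mx (t%:A + h)) = const_mx t :> 'rV_1.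
  by apply/matrixP => a b; rewrite !mxE scalar_part_unique.
have e2 : (const_mx (t%:A + h) : 'rV[A]_1) - map_mx (in_alg A) (const_mx t)
  = const_mx h by apply/matrixP => a b; rewrite !mxE /=; ring.
rewrite e1 e2.
rewrite (reindex (fun k : 'I_(weil_index A).+1 => [ffun _ : 'I_1 => k])) /=.
  apply: eq_big => [k|k _]; first by rewrite big_ord1 ffunE -ltnS ltn_ord.
  rewrite !big_ord1 !ffunE mxE; congr (_ *: _); congr (_ * _).
  by rewrite /mpartial enum_ordSl enum_ord0 /= ffunE.
exists (fun alpha => alpha ord0) => [k _|alpha _]; first by rewrite ffunE.
by apply/ffunP => i; rewrite ffunE [i]ord1; congr (alpha _); apply: val_inj.
Qed.

End OverWeilAlgebra.

End PowerSeries.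

(** * The functions a and b as entire limits *)

Section RodriguesProlongation.
Variable R : realType.

Lemma rodrigues_a_coef_le k : `|rodrigues_a_coef R k| <= 1 ^+ k / k`!%:R.
Proof.
rewrite normrM normrX normrN1 !expr1n normfV normr_nat.
rewrite !mul1r lef_pV2 ?posrE ?ltr0n ?fact_gt0 // ler_nat leq_fact //.
by rewrite -addnn -addnS leq_addr.
Qed.

Lemma rodrigues_b_coef_le k : `|rodrigues_b_coef R k| <= 1 ^+ k / k`!%:R.
Proof.
rewrite normrM normrX normrN1 !expr1n normfV normr_nat.
rewrite !mul1r lef_pV2 ?posrE ?ltr0n ?fact_gt0 // ler_nat leq_fact //.
by rewrite -addnn -!addnS leq_addr.
Qed.

Lemma entire_rodrigues_a :
  entire_limit (power_sum (@rodrigues_a_coef R))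
    (fun x : 'rV[R]_1 => rodrigues_a (x 0 0)).
Proof.
exact: (@entire_power_sum _ _ 1) rodrigues_a_coef_le (@cvg_rodrigues_a R).
Qed.

Lemma entire_rodrigues_b :
  entire_limit (power_sum (@rodrigues_b_coef R))
    (fun x : 'rV[R]_1 => rodrigues_b (x 0 0)).
Proof.
exact: (@entire_power_sum _ _ 1) rodrigues_b_coef_le (@cvg_rodrigues_b R).
Qed.

End RodriguesProlongation.

(** * Transfer of functional identities from the reals to a Weil algebra *)

Lemma entire_limit_nat (R : realType) p k :
  entire_limit (fun=> k%:R : mpoly p R) (fun=> k%:R).
Proof.
have -> : (fun=> k%:R) = (fun x : 'rV[R]_p => meval (x 0) k%:R).
  by apply/funext => x; rewrite rmorph_nat.
exact: entire_limit_cst.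
Qed.

Lemma entire_limit_varX (R : realType) :
  entire_limit (fun=> varX R) (fun x : 'rV[R]_1 => x 0 0).
Proof.
have -> : (fun x : 'rV[R]_1 => x 0 0) = (fun x => meval (x 0) (varX R)).
  by apply/funext => x; rewrite meval_varX.
exact: entire_limit_cst.
Qed.

Section ProlongsTo.
Variables (R : realType) (A : weilAlgType R) (T : A).
Implicit Types (f g : R -> R) (y z : A).

(** The same polynomials approximate [f] on the reals and [y] at [T]. The relation is stable under
    differences and products and determines [y], so real identities carry over to [A]. *)
Definition prolongs_to f y := exists2 Ps,
  entire_limit Ps (fun x : 'rV[R]_1 => f (x 0 0)) &
  cvgA (fun n => eval_at T (Ps n)) y.

Lemma weil_prolongation1_eq f y : prolongs_to f y -> weil_prolongation1 f T = y.
Proof. by case=> Ps Pf /(weil_prolongation1_unique Pf). Qed.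

Lemma prolongs_to_eq f g y z : f =1 g -> prolongs_to f y -> prolongs_to g z ->
  y = z.
Proof.
by move=> /funext -> /weil_prolongation1_eq <- /weil_prolongation1_eq <-.
Qed.

Lemma prolongs_toB f g y z : prolongs_to f y -> prolongs_to g z ->
  prolongs_to (fun s => f s - g s) (y - z).
Proof.
move=> [Ps Pf Py] [Qs Qg Qz]; exists (fun n => Ps n - Qs n).
  exact: entire_limitB.
under eq_fun do rewrite rmorphB -mulN1r.
rewrite -[- z]mulN1r; apply: cvgAD => //; apply: cvgAM => //; exact: cvgA_cst.
Qed.

Lemma prolongs_toM f g y z : prolongs_to f y -> prolongs_to g z ->
  prolongs_to (fun s => f s * g s) (y * z).
Proof.
move=> [Ps Pf Py] [Qs Qg Qz]; exists (fun n => Ps n * Qs n).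
  exact: entire_limitM.
by under eq_fun do rewrite rmorphM; apply: cvgAM.
Qed.

Lemma prolongs_to_nat k : prolongs_to (fun=> k%:R) k%:R.
Proof.
exists (fun=> k%:R); first exact: entire_limit_nat.
by under eq_fun do rewrite rmorph_nat; apply: cvgA_cst.
Qed.

Lemma prolongs_to_id : prolongs_to id T.
Proof.
exists (fun=> varX R); first exact: entire_limit_varX.
by under eq_fun do rewrite eval_at_varX; apply: cvgA_cst.
Qed.

(** Multiplying the k-th coefficient by [4 ^+ k] gives polynomials whose values at [T] are those of
    the original partial sums at [4 * T]. *)
Lemma prolongs_to_mul4 c f : (forall k, `|c k| <= 1 ^+ k / k`!%:R) ->
  (forall s, ((fun n => \sum_(k < n) c k * s ^+ k) @ \oo --> f s)%classic) ->
  prolongs_to (fun s => f (4 * s)) (weil_prolongation1 f (4 * T)).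
Proof.
move=> cb cf; exists (power_sum (fun k => 4 ^+ k * c k)).
  apply: (@entire_power_sum _ _ 4 (fun s => f (4 * s))) => // [k|s].
    rewrite normrM ger0_norm ?exprn_ge0 // ler_wpM2l ?exprn_ge0 //.
    by have := cb k; rewrite expr1n mul1r.
  apply: eq_cvgn (cf (4 * s)) => // n; apply: eq_bigr => k _.
  by rewrite exprMn mulrCA mulrA.
have := @weil_prolongation1_limit R A _ f (4 * T) (entire_power_sum ler01 cb cf).
congr cvgA; apply/funext => n; rewrite !eval_at_power_sum.
apply: eq_bigr => k _.
by rewrite mulr_natl -scaler_nat exprZn scalerA mulrC.
Qed.

End ProlongsTo.

(** * The trigonometric identities over a Weil algebra *)

Section RodriguesOverA.
Variables (R : realType) (A : weilAlgType R).
Implicit Types T : A.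

Local Notation aA := (@weil_prolongation1 R A (@rodrigues_a R)).
Local Notation bA := (@weil_prolongation1 R A (@rodrigues_b R)).

Lemma prolongs_to_a T : prolongs_to T (@rodrigues_a R) (aA T).
Proof.
exists (power_sum (@rodrigues_a_coef R)); first exact: entire_rodrigues_a.
exact: weil_prolongation1_limit (entire_rodrigues_a R).
Qed.

Lemma prolongs_to_b T : prolongs_to T (@rodrigues_b R) (bA T).
Proof.
exists (power_sum (@rodrigues_b_coef R)); first exact: entire_rodrigues_b.
exact: weil_prolongation1_limit (entire_rodrigues_b R).
Qed.

(* 1 - s b(s) is the entire function cos (sqrt s). *)
Lemma prolongs_to_cos T :
  prolongs_to T (fun s => 1%:R - s * rodrigues_b s) (1 - T * bA T).
Proof.
apply: prolongs_toB; first exact: (prolongs_to_nat T 1).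
exact: (prolongs_toM (prolongs_to_id T) (prolongs_to_b T)).
Qed.

Lemma weil_rodrigues_a_mul4 T : aA (4 * T) = (1 - T * bA T) * aA T.
Proof.
apply: prolongs_to_eq (@rodrigues_a_mul4 R) _ _; last first.
  exact: (prolongs_toM (prolongs_to_cos T) (prolongs_to_a T)).
exact: prolongs_to_mul4 (@rodrigues_a_coef_le R) (@cvg_rodrigues_a R).
Qed.

Lemma weil_rodrigues_b_mul4 T : 2 * bA (4 * T) = aA T ^+ 2.
Proof.
apply: prolongs_to_eq (@rodrigues_b_mul4 R) _ _; last first.
  exact: (prolongs_toM (prolongs_to_a T) (prolongs_to_a T)).
apply: (prolongs_toM (prolongs_to_nat T 2)).
exact: prolongs_to_mul4 (@rodrigues_b_coef_le R) (@cvg_rodrigues_b R).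
Qed.

Lemma weil_rodrigues_a_sqr T : aA T ^+ 2 = bA T * (2 - T * bA T).
Proof.
apply: prolongs_to_eq (@rodrigues_a_sqrE R) _ _.
  exact: (prolongs_toM (prolongs_to_a T) (prolongs_to_a T)).
apply: (prolongs_toM (prolongs_to_b T)).
apply: (prolongs_toB (prolongs_to_nat T 2)).
exact: (prolongs_toM (prolongs_to_id T) (prolongs_to_b T)).
Qed.

End RodriguesOverA.

(** * The derivative of cos (sqrt s) *)

Section CosDerivative.
Variable R : realType.

(** This is the coefficient form of (s b(s))' = a(s) / 2. *)
Lemma rodrigues_coefE k :
  k.+1%:R * rodrigues_b_coef R k = rodrigues_a_coef R k / 2.
Proof.
rewrite /rodrigues_a_coef /rodrigues_b_coef factS natrM invfM.
have -> : k.*2.+2%:R = 2 * k.+1%:R :> R by rewrite -natrM mul2n doubleS.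
by field; rewrite nat1r !pnatr_eq0 -lt0n fact_gt0.
Qed.

Lemma meval_deriv_varXn (x : 'rV[R]_1) k :
  meval (x 0) (mderiv 0 (varX R ^+ k)) = k%:R * x 0 0 ^+ k.-1.
Proof.
rewrite /varX mpolyXn mderivX mevalZ mevalX big_ord1 mnmBE mulmnE mnm1E eqxx.
by rewrite mul1n subn1.
Qed.

Lemma partial_cos (t : R) :
  partial 0 (fun x : 'rV[R]_1 =>
    const_mx (1 - x 0 0 * rodrigues_b (x 0 0)) : 'rV[R]_1) (const_mx t) 0 0
  = - (rodrigues_a t / 2).
Proof.
pose Ps n := 1%:R - varX R * power_sum (@rodrigues_b_coef R) n.
pose F (x : 'rV[R]_1) := const_mx (1 - x 0 0 * rodrigues_b (x 0 0)) : 'rV[R]_1.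
have PF j : entire_limit Ps (fun x => F x 0 j).
  under eq_fun do rewrite mxE.
  apply: entire_limitB (entire_limit_nat R 1 1) _.
  exact: entire_limitM (entire_limit_varX R) (entire_rodrigues_b R).
have [_ /(_ (const_mx t)) Pt] := @entire_limit_iter_partial _ _ _ (fun=> Ps) F 0 1 PF 0.
rewrite /= in Pt; apply: cvg_unique Pt _ => //.
apply: (eq_cvgn _ _ (cvgM (@cvg_rodrigues_a R t) (cvg_cst (- 2^-1 : R)))) => // [n|].
  rewrite /Ps /power_sum mderivB mevalB -(mpolyC_nat _ _ 1) mderivC.
  rewrite meval0 sub0r mulr_sumr /= mulr_suml.
  rewrite [mderiv _ _]raddf_sum [meval _ _]raddf_sum -sumrN.
  apply: eq_bigr => k _ /=.
  rewrite -scalerAr -exprS mderivZ mevalZ meval_deriv_varXn mxE /=.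
  rewrite mulrN mulrAC -rodrigues_coefE; ring.
by rewrite mulrN.
Qed.

End CosDerivative.

(** * Hensel's lemma, inverses and square roots *)

Section Hensel.
Variables (R : realType) (A : weilAlgType R).
Local Notation m := (weil_max A).
Local Notation N := (weil_index A).

Lemma weil_maxX_ideal j (u x : A) :
  u \in (m ^+ j.+1)%VS -> u * x \in (m ^+ j.+1)%VS.
Proof.
move=> uj; have : (m ^+ j.+1 * fullv <= m ^+ j.+1)%VS.
  rewrite expvSr -prodvA prodvSr //; apply/prodvP => h y hm _.
  by rewrite mulrC weil_maxM.
by move=> /subvP; apply; rewrite memv_mul ?memvf.
Qed.

(** Newton iteration with the constant slope [c 1]: each correction moves the error one power deeper
    into the ideal, until that power is zero. *)
Lemma weil_hensel M (c : nat -> R) (d : A) : c 1%N != 0 -> d \in m ->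
  exists2 h, h \in m & \sum_(k < M.+2) c k *: h ^+ k = (c 0%N)%:A + d.
Proof.
move=> c1 dm; pose P h : A := \sum_(k < M.+2) c k *: h ^+ k.
suff [h hm] : exists2 h, h \in m & (c 0%N)%:A + d - P h \in (m ^+ N.+1)%VS.
  by rewrite weil_nilpotent memv0 subr_eq0 => /eqP Ph; exists h.
elim: N => [|j [h hm ej]].
  exists 0; first exact: mem0v.
  rewrite /P big_ord_recl big1 => [|k _]; last by rewrite expr0n scaler0.
  by rewrite expr0 addr0 [_ + d]addrC addrK expv1.
set e := _ - P h in ej; pose del := (c 1%N)^-1 *: e.
have dj : del \in (m ^+ j.+1)%VS by rewrite rpredZ.
have delm : del \in m.
  apply: subvP dj; rewrite expvSr; apply/prodvP => x y _ ym.
  exact: weil_maxM.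
have h'm : h + del \in m by rewrite rpredD.
exists (h + del) => //.
have Pdiff : P (h + del) - P h =
    e + \sum_(k < M) c k.+2 *: ((h + del) ^+ k.+2 - h ^+ k.+2).
  rewrite /P -sumrB !big_ord_recl /= !expr0 subrr add0r.
  congr (_ + _).
    by rewrite !expr1 -scalerBr [h + del]addrC addrK scalerA mulfV // scale1r.
  by apply: eq_bigr => k _; rewrite scalerBr.
have -> : (c 0%N)%:A + d - P (h + del) = e - (P (h + del) - P h).
  by rewrite /e; ring.
rewrite Pdiff opprD addrA subrr sub0r.
rewrite rpredN rpred_sum // => k _; rewrite rpredZ //.
(* The linear term has cancelled [e]. A term of degree at least 2 changes by [del] times an element
   of the ideal, which gains one power. *)
have -> : (h + del) ^+ k.+2 - h ^+ k.+2 =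
   (h + del) * ((h + del) ^+ k.+1 - h ^+ k.+1) + h ^+ k.+1 * del.
  by rewrite !exprS; ring.
rewrite [(m ^+ _)%VS]expvSl rpredD //.
  rewrite memv_mul // subrXX [h + del]addrC addrK.
  exact: weil_maxX_ideal.
by rewrite memv_mul // exprS mulrC weil_maxM.
Qed.

(** Up to its scalar part, [x] is 1 minus a nilpotent [u], inverted by a finite geometric series. *)
Lemma weil_inverse (x : A) : scalar_part x != 0 -> exists y, x * y = 1.
Proof.
move=> x0; set r := scalar_part x in x0.
pose u : A := 1 - r^-1 *: x.
have um : u \in m.
  by rewrite -scalar_part_eq0 /u scalar_partD scalar_partN scalar_partZ
    scalar_part1 mulVf // subrr.
pose S := \sum_(i < N.+1) 1 ^+ (N.+1.-1 - i) * u ^+ i.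
exists (r^-1 *: S); rewrite -scalerAr scalerAl.
have := subrXX 1 u N.+1; rewrite expr1n weil_nilpotentX // subr0 -/S.
by rewrite {1}/u subKr => <-.
Qed.

Lemma weil_sqrt (x : A) : 0 < scalar_part x ->
  exists2 y, y ^+ 2 = x & 0 < scalar_part y.
Proof.
set r := scalar_part x => r0.
(* These are the coefficients of the square of [Num.sqrt r + h] as a polynomial in [h]. *)
pose c (k : nat) : R := nth 0 [:: r; 2 * Num.sqrt r; 1] k.
have [|h hm hx] := @weil_hensel 1 c (x - r%:A) _ (scalar_part_max x).
  by rewrite /c /= mulf_neq0 // gt_eqF // sqrtr_gt0.
exists ((Num.sqrt r)%:A + h); last by rewrite scalar_part_unique // sqrtr_gt0.
move: hx; rewrite !big_ord_recl big_ord0 /c /= expr0 expr1 addr0.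
have <- : (Num.sqrt r)%:A ^+ 2 = r%:A :> A.
  by rewrite -(rmorphXn (in_alg A)) /= sqr_sqrtr // ltW.
rewrite -scalerA scaler_nat -mulr_natl -[X in 2 * X]mulr_algl scale1r.
have key (q z : A) : q ^+ 2 + (2 * (q * h) + h ^+ 2) = q ^+ 2 + (z - q ^+ 2) ->
    (q + h) ^+ 2 = z.
  have -> : (q + h) ^+ 2 = q ^+ 2 + (2 * (q * h) + h ^+ 2) by ring.
  by move=> ->; ring.
exact: key.
Qed.

End Hensel.

(** * Skew matrices, quaternion matrices and cofactors of rotations *)

Section RotationMatrices.
Variable A : comNzRingType.
Implicit Types (phi : 'cV[A]_3) (Q : 'M[A]_3) (q : nat -> nat -> A).

Lemma ord3_ind (P : 'I_3 -> Prop) :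
  P (@Ordinal 3 0 isT) -> P (@Ordinal 3 1 isT) -> P (@Ordinal 3 2 isT) ->
  forall i, P i.
Proof.
move=> P0 P1 P2 [[|[|[|//]]] lti]; rewrite (bool_irrelevance lti isT) //.
Qed.

Lemma sqr_norm3E phi :
  (phi^T *m phi) 0 0 = phi 0 0 ^+ 2 + phi 1 0 ^+ 2 + phi 2 0 ^+ 2.
Proof.
rewrite mxE !big_ord_recl big_ord0 !mxE.
have -> : lift ord0 ord0 = 1 :> 'I_3 by apply: val_inj.
have -> : lift ord0 (lift ord0 ord0) = 2 :> 'I_3 by apply: val_inj.
have -> : ord0 = 0 :> 'I_3 by apply: val_inj.
by ring.
Qed.

Lemma cross_mx_so3 phi : in_so3 (cross_mx phi).
Proof.
apply/matrixP; do 2!apply: ord3_ind; rewrite !mxE /=; ring.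
Qed.

(** This is the Cayley-Hamilton identity: with S the squared norm of [phi], the characteristic
    polynomial is X^3 + S X. *)
Lemma cross_mx_cube phi :
  cross_mx phi *m (cross_mx phi *m cross_mx phi) =
  - ((phi^T *m phi) 0 0) *: cross_mx phi.
Proof.
rewrite sqr_norm3E; apply/matrixP; do 2!apply: ord3_ind;
  rewrite !(mxE, big_ord_recl, big_ord0) /=; ring.
Qed.

Lemma cross_mx_odd_pow phi k :
  cross_mx phi ^+ k.*2.+1 = (- ((phi^T *m phi) 0 0)) ^+ k *: cross_mx phi.
Proof.
elim: k => [|k IH]; first by rewrite expr1 expr0 scale1r.
rewrite doubleS 2!exprSr IH -!scalerAl -mulrA.
have := cross_mx_cube phi; rewrite !mulmxE => ->.
by rewrite scalerA exprSr.
Qed.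

(** For a unit quaternion p this is the Euler-Rodrigues matrix of the rotation sending v to p v
    p^-1. *)
Definition quat_mx (p0 p1 p2 p3 : A) : 'M[A]_3 :=
  \matrix_(i, j) nth 0 (nth [::] [::
    [:: p0 ^+ 2 + p1 ^+ 2 - p2 ^+ 2 - p3 ^+ 2; 2 * (p1 * p2 - p0 * p3);
        2 * (p1 * p3 + p0 * p2)];
    [:: 2 * (p1 * p2 + p0 * p3); p0 ^+ 2 - p1 ^+ 2 + p2 ^+ 2 - p3 ^+ 2;
        2 * (p2 * p3 - p0 * p1)];
    [:: 2 * (p1 * p3 - p0 * p2); 2 * (p2 * p3 + p0 * p1);
        p0 ^+ 2 - p1 ^+ 2 - p2 ^+ 2 + p3 ^+ 2]] i) j.

Definition col3 (x y z : A) : 'cV[A]_3 := \col_i nth 0 [:: x; y; z] i.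

Lemma quat_mxE p0 p1 p2 p3 : p0 ^+ 2 + p1 ^+ 2 + p2 ^+ 2 + p3 ^+ 2 = 1 ->
  let P := cross_mx (col3 p1 p2 p3) in
  quat_mx p0 p1 p2 p3 = 1%:M + (2 * p0) *: P + 2 *: (P *m P).
Proof.
(* Replacing 1 by the squared norm makes both sides homogeneous quadratic, hence equal as
   polynomials. *)
move=> e P; have -> : 1%:M = (p0 ^+ 2 + p1 ^+ 2 + p2 ^+ 2 + p3 ^+ 2)%:M :> 'M[A]_3.
  by rewrite e.
apply/matrixP; do 2!apply: ord3_ind;
  rewrite !(mxE, big_ord_recl, big_ord0) /=; ring.
Qed.

Lemma quat_mxN p0 p1 p2 p3 :
  quat_mx (- p0) (- p1) (- p2) (- p3) = quat_mx p0 p1 p2 p3.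
Proof.
by apply/matrixP; do 2!apply: ord3_ind; rewrite !mxE /=; ring.
Qed.

(** Indexing by natural numbers makes the entries plain atoms for [ring]. *)
Definition mx3 q : 'M[A]_3 := \matrix_(i, j) q i j.

Lemma mx3E Q : Q = mx3 (fun i j => Q (inord i) (inord j)).
Proof. by apply/matrixP => i j; rewrite mxE !inord_val. Qed.

Lemma in_SO3_adj Q : in_SO3 Q -> \adj Q = Q^T.
Proof.
move=> [QQ dQ]; have := mul_mx_adj Q; rewrite dQ => QA.
by rewrite -[LHS]mul1mx -QQ -mulmxA QA mulmx1.
Qed.

Lemma det_mx22 (M : 'M[A]_2) :
  \det M = M ord0 ord0 * M ord_max ord_max - M ord0 ord_max * M ord_max ord0.
Proof.
rewrite (expand_det_row _ ord0) !big_ord_recl big_ord0 /cofactor !det_mx11 !mxE.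
have e1 : lift ord0 ord0 = ord_max :> 'I_2 by apply: val_inj.
have e2 : lift ord_max ord0 = ord0 :> 'I_2 by apply: val_inj.
by rewrite ?(e1, e2) /= ?expr0 ?expr1; ring.
Qed.

(** The adjugate of a rotation is its transpose, so each entry equals its own cofactor. *)
Lemma mx3_cofactors q : in_SO3 (mx3 q) ->
  [/\ [/\ q 0%N 0%N = q 1%N 1%N * q 2%N 2%N - q 1%N 2%N * q 2%N 1%N,
          q 0%N 1%N = q 1%N 2%N * q 2%N 0%N - q 1%N 0%N * q 2%N 2%N &
          q 0%N 2%N = q 1%N 0%N * q 2%N 1%N - q 1%N 1%N * q 2%N 0%N],
      [/\ q 1%N 0%N = q 0%N 2%N * q 2%N 1%N - q 0%N 1%N * q 2%N 2%N,
          q 1%N 1%N = q 0%N 0%N * q 2%N 2%N - q 0%N 2%N * q 2%N 0%N &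
          q 1%N 2%N = q 0%N 1%N * q 2%N 0%N - q 0%N 0%N * q 2%N 1%N] &
      [/\ q 2%N 0%N = q 0%N 1%N * q 1%N 2%N - q 0%N 2%N * q 1%N 1%N,
          q 2%N 1%N = q 0%N 2%N * q 1%N 0%N - q 0%N 0%N * q 1%N 2%N &
          q 2%N 2%N = q 0%N 0%N * q 1%N 1%N - q 0%N 1%N * q 1%N 0%N]].
Proof.
move=> /in_SO3_adj /matrixP QA; split; split.
all: match goal with |- ?r ?i ?j = _ =>
  have := QA (@Ordinal 3 j isT) (@Ordinal 3 i isT) end.
all: by rewrite !mxE /cofactor det_mx22 !mxE /= => <-; ring.
Qed.

Lemma mx3_orthonormal q : in_SO3 (mx3 q) ->
  (forall i j, (i < 3)%N -> (j < 3)%N ->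
   q 0%N i * q 0%N j + q 1%N i * q 1%N j + q 2%N i * q 2%N j = (i == j)%:R) /\
  (forall i j, (i < 3)%N -> (j < 3)%N ->
   q i 0%N * q j 0%N + q i 1%N * q j 1%N + q i 2%N * q j 2%N = (i == j)%:R).
Proof.
move=> [QQ _]; have QQ' := mulmx1C QQ; split=> i j i3 j3.
  move/matrixP: QQ => /(_ (Ordinal i3) (Ordinal j3)).
  by rewrite !(mxE, big_ord_recl, big_ord0) /= addr0 addrA.
move/matrixP: QQ' => /(_ (Ordinal i3) (Ordinal j3)).
by rewrite !(mxE, big_ord_recl, big_ord0) /= addr0 addrA.
Qed.

Lemma in_SO3_mul P Q : in_SO3 P -> in_SO3 Q -> in_SO3 (P *m Q).
Proof.
move=> [PP dP] [QQ dQ]; split; last by rewrite det_mulmx dP dQ mulr1.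
by rewrite trmx_mul mulmxA -[_ *m P^T *m P]mulmxA PP mulmx1.
Qed.

End RotationMatrices.

(** A certificate format: the goal follows from four equations once [ring] checks the stated
    combination. *)
Lemma lincomb (A : comNzRingType) (k l a a' b b' c c' d d' x y : A) :
  a = a' -> b = b' -> c = c' -> d = d' ->
  x - y = k * (a - a') + (b - b') + (c - c') + l * (d - d') -> x = y.
Proof.
move=> -> -> -> ->; rewrite !subrr !mulr0 !addr0 => /eqP.
by rewrite subr_eq0 => /eqP.
Qed.

(** * Rank-one relations satisfied by the entries of a rotation *)

Section RankOne.
Variables (A : comNzRingType) (q : nat -> nat -> A).
Hypothesis Sq : in_SO3 (mx3 q).
Local Notation t := (1 + q 0%N 0%N + q 1%N 1%N + q 2%N 2%N).
Local Notation v1 := (q 2%N 1%N - q 1%N 2%N).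
Local Notation v2 := (q 0%N 2%N - q 2%N 0%N).
Local Notation v3 := (q 1%N 0%N - q 0%N 1%N).

(* 4 p p^T, for p the unit quaternion of the rotation, has rank one, and its
   entries are linear in the matrix of the rotation. *)
Lemma SO3_rank_one :
  [/\ [/\ v1 ^+ 2 = t * (1 + q 0%N 0%N - q 1%N 1%N - q 2%N 2%N),
          v2 ^+ 2 = t * (1 - q 0%N 0%N + q 1%N 1%N - q 2%N 2%N) &
          v3 ^+ 2 = t * (1 - q 0%N 0%N - q 1%N 1%N + q 2%N 2%N)] &
      [/\ v1 * v2 = t * (q 0%N 1%N + q 1%N 0%N),
          v1 * v3 = t * (q 0%N 2%N + q 2%N 0%N) &
          v2 * v3 = t * (q 1%N 2%N + q 2%N 1%N)]].
Proof.
have [[G00 G01 G02] [G10 G11 G12] [G20 G21 G22]] := mx3_cofactors Sq.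
have [E F] := mx3_orthonormal Sq.
have E00 := E 0%N 0%N isT isT; have E11 := E 1%N 1%N isT isT.
have E22 := E 2%N 2%N isT isT; have E01 := E 0%N 1%N isT isT.
have E02 := E 0%N 2%N isT isT; have E12 := E 1%N 2%N isT isT.
have F00 := F 0%N 0%N isT isT; have F11 := F 1%N 1%N isT isT.
have F22 := F 2%N 2%N isT isT; have F01 := F 0%N 1%N isT isT.
have F02 := F 0%N 2%N isT isT; have F12 := F 1%N 2%N isT isT.
rewrite /= in E00 E11 E22 E01 E02 E12 F00 F11 F22 F01 F02 F12.
clear E F Sq.
split; split.
(* Squares use one cofactor identity and three unit-length relations; mixed products use two
   cofactor identities and the orthogonality of two rows and two columns. *)
- by apply: (lincomb (k := (- 2)) (l := - 1) G00 F11 F22 E00); ring.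
- by apply: (lincomb (k := (- 2)) (l := - 1) G11 F00 F22 E11); ring.
- by apply: (lincomb (k := (- 2)) (l := - 1) G22 F00 F11 E22); ring.
- by apply: (lincomb (k := 1) (l := - 1) (esym G01) (esym G10) (esym E01) F01); ring.
- by apply: (lincomb (k := 1) (l := - 1) (esym G02) (esym G20) (esym E02) F02); ring.
- by apply: (lincomb (k := 1) (l := - 1) (esym G12) (esym G21) (esym E12) F12); ring.
Qed.

End RankOne.

(** * Every rotation over a Weil algebra comes from a unit quaternion *)

Section Quaternions.
Variables (R : realType) (A : weilAlgType R).

Definition is_quaternion_of (Q : 'M[A]_3) (p0 p1 p2 p3 : A) :=
  Q = quat_mx p0 p1 p2 p3 /\ p0 ^+ 2 + p1 ^+ 2 + p2 ^+ 2 + p3 ^+ 2 = 1.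

Lemma quaternion_of_trace (q : nat -> nat -> A) : in_SO3 (mx3 q) ->
  0 < scalar_part (1 + q 0%N 0%N + q 1%N 1%N + q 2%N 2%N) ->
  exists p0 p1 p2 p3, is_quaternion_of (mx3 q) p0 p1 p2 p3.
Proof.
move=> Sq; have [[K11 K22 K33] [K12 K13 K23]] := SO3_rank_one Sq.
set t := 1 + _ + _ + _ in K11 K22 K33 K12 K13 K23 *.
move=> /weil_sqrt [s st s0].
have [y sy] := weil_inverse (lt0r_neq0 s0).
pose h : A := (2^-1)%:A.
have h2 : 2 * h = 1.
  by rewrite mulr_natl /h -scaler_nat scalerA divff ?scale1r ?pnatr_eq0.
have yt : y ^+ 2 * t = 1 by rewrite -st -exprMn mulrC sy expr1n.
(* As [t] is to be 4 p0^2, p0 is half its root [s], and the other components are the antisymmetric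
   part of [q] divided by [2 * s]. *)
exists (h * s), (h * (y * (q 2%N 1%N - q 1%N 2%N))),
  (h * (y * (q 0%N 2%N - q 2%N 0%N))), (h * (y * (q 1%N 0%N - q 0%N 1%N))).
have prod_v u v k : u * v = t * k ->
    (h * (y * u)) * (h * (y * v)) = h ^+ 2 * k.
  move=> uv; transitivity (h ^+ 2 * (y ^+ 2 * (u * v))); first by ring.
  by rewrite uv [y ^+ 2 * _]mulrA yt mul1r.
have prod_s u : (h * s) * (h * (y * u)) = h ^+ 2 * u.
  by transitivity (h ^+ 2 * (s * y) * u); [ring | rewrite sy mulr1].
have e00 : (h * s) ^+ 2 = h ^+ 2 * t by rewrite exprMn st.
have sqr_v u k : u ^+ 2 = t * k -> (h * (y * u)) ^+ 2 = h ^+ 2 * k.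
  by move=> uk; rewrite expr2; apply: prod_v.
have e11 := sqr_v _ _ K11; have e22 := sqr_v _ _ K22.
have e33 := sqr_v _ _ K33; have e12 := prod_v _ _ _ K12.
have e13 := prod_v _ _ _ K13; have e23 := prod_v _ _ _ K23.
have four x : x = (2 * h) * (2 * h) * x by rewrite h2 !mul1r.
split.
  apply/matrixP; do 2!apply: ord3_ind; rewrite !mxE /=
    ?prod_s ?e00 ?e11 ?e22 ?e33 ?e12 ?e13 ?e23 /t [LHS]four; ring.
by rewrite e00 e11 e22 e33 /t [RHS]four; ring.
Qed.

(** The rotation by pi about axis [k], whose quaternion is the corresponding imaginary unit. *)
Definition half_turn k : 'M[A]_3 :=
  diag_mx (\row_(j < 3) if (j : nat) == k then 1 else - 1).

Lemma half_turnK k : half_turn k *m half_turn k = 1%:M.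
Proof.
rewrite mulmx_diag -diag_const_mx; congr diag_mx; apply/rowP => j.
by rewrite !mxE; case: eqP; rewrite ?mulr1 ?mulrNN ?mulr1.
Qed.

Lemma half_turn_SO3 k : (k < 3)%N -> in_SO3 (half_turn k).
Proof.
move=> k3; split; first by rewrite tr_diag_mx half_turnK.
rewrite det_diag !big_ord_recl big_ord0 !mxE /=.
by case: k k3 => [|[|[|]]] //= _; ring.
Qed.

Lemma quaternion_exists (Q : 'M[A]_3) : in_SO3 Q ->
  exists p0 p1 p2 p3, is_quaternion_of Q p0 p1 p2 p3.
Proof.
rewrite (mx3E Q); move: (fun i j => Q (inord i) (inord j)) => q {Q} SQ.
have turn (k : nat) (k3 : (k < 3)%N) : half_turn k *m mx3 q =
    mx3 (fun i j => (if i == k then 1 else -1) * q i j).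
  by apply/matrixP => i j; rewrite mul_diag_mx !mxE.
have Sk (k : nat) (k3 : (k < 3)%N) := in_SO3_mul (half_turn_SO3 k3) SQ.
have back (k : nat) (P : 'M[A]_3) :
    half_turn k *m mx3 q = P -> mx3 q = half_turn k *m P.
  by move=> <-; rewrite mulmxA half_turnK mul1mx.
pose tr := scalar_part (1 + q 0%N 0%N + q 1%N 1%N + q 2%N 2%N).
have [/quaternion_of_trace|] := ltP 0 tr; first exact.
rewrite /tr; move=> t0.
pose e (k i : nat) : A := if i == k then 1 else -1.
pose tk k := scalar_part (1 + e k 0%N * q 0%N 0%N + e k 1%N * q 1%N 1%N +
  e k 2%N * q 2%N 2%N).
(* The four diagonal entries of the rank-one matrix sum to 4, so one is positive; a half turn moves
   it to the position of 4 p0^2. *)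
have [k k3 tk0] : exists2 k, (k < 3)%N & 0 < tk k.
  have : tr + tk 0%N + tk 1%N + tk 2%N = 4.
    rewrite /tr /tk -!scalar_partD; transitivity (scalar_part (4%:R%:A : A)).
      congr scalar_part; rewrite scaler_nat /e /=; ring.
    by rewrite scalar_part_alg.
  rewrite -/tr in t0; have [|t1] := ltP 0 (tk 0%N); first by exists 0%N.
  have [|t2] := ltP 0 (tk 1%N); first by exists 1%N.
  have [|t3] := ltP 0 (tk 2%N); first by exists 2%N.
  by lra.
have := Sk k k3; rewrite turn // => /quaternion_of_trace /(_ tk0).
move=> [p0 [p1 [p2 [p3 []]]]]; rewrite -turn // => /back -> np.
case: k k3 {tk0} => [|[|[|//]]] _.
(* The witnesses are the products of the imaginary units i, j and k with the quaternion found,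
   undoing the half turn. *)
- exists (- p1), p0, (- p3), p2; split; last by rewrite -np; ring.
  by rewrite mul_diag_mx; apply/matrixP; do 2!apply: ord3_ind; rewrite !mxE /=; ring.
- exists (- p2), p3, p0, (- p1); split; last by rewrite -np; ring.
  by rewrite mul_diag_mx; apply/matrixP; do 2!apply: ord3_ind; rewrite !mxE /=; ring.
- exists (- p3), (- p2), p1, p0; split; last by rewrite -np; ring.
  by rewrite mul_diag_mx; apply/matrixP; do 2!apply: ord3_ind; rewrite !mxE /=; ring.
Qed.

End Quaternions.

(** * Rodrigues' formula over a Weil algebra *)

Section RodriguesFormula.
Variables (R : realType) (A : weilAlgType R).
Local Notation aA := (@weil_prolongation1 R A (@rodrigues_a R)).
Local Notation bA := (@weil_prolongation1 R A (@rodrigues_b R)).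

Lemma Exp_cross_mx (phi : 'cV[A]_3) (S := (phi^T *m phi) 0 0) :
  Exp (cross_mx phi) = 1%:M + aA S *: cross_mx phi
                       + bA S *: (cross_mx phi *m cross_mx phi).
Proof.
set B := cross_mx phi; apply/matrixP => i j.
(* A partial sum with [n.*2.+1] terms holds the identity, [n] odd powers and [n] positive even
   powers, thus [n] terms of each of the series of a and b. *)
have smono : {homo (fun n => n.*2.+1) : k l / (k < l)%N}.
  by move=> k l; rewrite ltnS ltn_double.
have := @cvgA_subseq _ _ _ _ _ smono (@weil_prolongation_mexp R 2 A B i j).
have -> : (fun k => \sum_(l < k) l`!%:R^-1 *: (B ^+ l) i j) \o (fun n => n.*2.+1) =
  (fun n => (1%:M : 'M[A]_3) i j + eval_at S (power_sum (@rodrigues_a_coef R) n) * B i j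
    + eval_at S (power_sum (@rodrigues_b_coef R) n) * (B *m B) i j).
  apply/funext => n /=; rewrite !eval_at_power_sum.
  elim: n => [|n IH].
    by rewrite !big_ord0 !mul0r !addr0 big_ord1 expr0 fact0 invr1 scale1r.
  rewrite doubleS 2!big_ord_recr /= IH !big_ord_recr /=.
  have := cross_mx_odd_pow phi n; rewrite -/B -/S => Bn.
  have Bn2 : B ^+ n.*2.+2 = (- S) ^+ n *: (B *m B) by rewrite exprSr Bn scalemxAl.
  have powS (c : R) (M : 'M[A]_3) : c *: (((- S) ^+ n *: M) i j) =
      (((-1) ^+ n * c) *: S ^+ n) * M i j.
    by rewrite mxE -scaleN1r exprZn -!scalerAl scalerA mulrC.
  rewrite Bn2 Bn !powS /rodrigues_a_coef /rodrigues_b_coef; ring.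
move=> /cvgA_unique; apply; rewrite !mxE; apply: cvgAD; last first.
  apply: cvgAM; last exact: cvgA_cst.
  exact: weil_prolongation1_limit (entire_rodrigues_b R).
apply: cvgAD; first exact: cvgA_cst.
apply: cvgAM; last exact: cvgA_cst.
exact: weil_prolongation1_limit (entire_rodrigues_a R).
Qed.

End RodriguesFormula.

(** * Surjectivity of the exponential onto rotations *)

Section Surjectivity.
Variables (R : realType) (A : weilAlgType R).
Local Notation aA := (@weil_prolongation1 R A (@rodrigues_a R)).
Local Notation bA := (@weil_prolongation1 R A (@rodrigues_b R)).

(** All Taylor terms beyond the first lie in the maximal ideal. *)
Lemma scalar_part_weil_prolongation1 (f : R -> R) (s : A) :
  scalar_part (weil_prolongation1 f s) = f (scalar_part s).
Proof.
have sm := scalar_part_max s; set h := s - _ in sm.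
have {1}-> : s = (scalar_part s)%:A + h by rewrite /h; ring.
rewrite weil_prolongation1_taylor // big_ord_recl /= invr1 mul1r expr0 mxE.
rewrite scalar_part_unique ?mxE // rpred_sum // => k _; rewrite rpredZ //.
by rewrite exprSr weil_maxM.
Qed.

Lemma cos_acos_b (c : R) : -1 <= c <= 1 ->
  1 - acos c ^+ 2 * rodrigues_b (acos c ^+ 2) = c.
Proof.
move=> c1; have := acos_ge0 c1; rewrite le_eqVlt => /orP[/eqP c0|c0].
  rewrite -c0 expr0n mul0r subr0 -[RHS]acosK ?in_itv //.
  by rewrite -c0 cos0.
rewrite rodrigues_b_sqr // mulrC divfK ?gt_eqF ?exprn_gt0 //.
by rewrite subKr acosK // in_itv.
Qed.

(** The value [c = -1] is excluded because acos is then pi, where the sine vanishes. *)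
Lemma rodrigues_a_acos_gt0 (c : R) : -1 < c <= 1 ->
  0 < rodrigues_a (acos c ^+ 2).
Proof.
move=> /andP[c1 c2]; have c12 : -1 <= c <= 1 by rewrite ltW.
have := acos_ge0 c12; rewrite le_eqVlt => /orP[/eqP <-|c0].
  by rewrite expr0n rodrigues_a0.
by rewrite rodrigues_a_sqr // divr_gt0 // sin_gt0_pi // c0 acos_ltpi ?c1.
Qed.

(* The derivative of cos (sqrt s) is - a(s) / 2, nonzero for sqrt s < pi. *)
Lemma weil_arccos (p : A) : -1 < scalar_part p <= 1 ->
  exists T : A, 1 - T * bA T = p /\ scalar_part (aA T) != 0.
Proof.
set c := scalar_part p => c1.
have c1' : -1 <= c <= 1 by case/andP: c1 => /ltW -> ->.
pose t := acos c ^+ 2; pose f (s : R) := 1 - s * rodrigues_b s.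
pose F (x : 'rV[R]_1) : 'rV[R]_1 := const_mx (f (x 0 0)).
pose C k := k`!%:R^-1 * iter k (partial 0) F (const_mx t) 0 0.
have a0 := rodrigues_a_acos_gt0 c1.
have [|h hm hp] := @weil_hensel R A (weil_index A) C _ _ (scalar_part_max p).
  rewrite /C (factS 0) fact0 invr1 mul1r /= partial_cos.
  by rewrite oppr_eq0 mulf_neq0 ?invr_eq0 ?gt_eqF.
exists (t%:A + h); split; last first.
  by rewrite scalar_part_weil_prolongation1 scalar_part_unique // gt_eqF.
rewrite -(weil_prolongation1_eq (prolongs_to_cos (t%:A + h))).
rewrite (@weil_prolongation1_taylor R A f t h hm) -/F.
have -> : p = (C 0%N)%:A + (p - c%:A).
  by rewrite /C fact0 invr1 mul1r /= /F !mxE /f /t cos_acos_b //; ring.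
(* Hensel's polynomial has one term more than the Taylor sum; its exponent exceeds the nilpotency
   index by one, so it vanishes. *)
by rewrite -hp [RHS]big_ord_recr /= [h ^+ _]weil_nilpotentX // scaler0 addr0.
Qed.

Lemma unit_quaternion_scalar_part (p0 p1 p2 p3 : A) :
  p0 ^+ 2 + p1 ^+ 2 + p2 ^+ 2 + p3 ^+ 2 = 1 -> -1 <= scalar_part p0 <= 1.
Proof.
move=> /(congr1 (@scalar_part R A)).
rewrite !scalar_partD !expr2 !scalar_partM scalar_part1 => np.
by apply/andP; split; nra.
Qed.

Lemma Exp_quat_mx (p0 p1 p2 p3 : A) : 0 <= scalar_part p0 ->
  p0 ^+ 2 + p1 ^+ 2 + p2 ^+ 2 + p3 ^+ 2 = 1 ->
  exists phi, quat_mx p0 p1 p2 p3 = Exp (cross_mx phi).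
Proof.
move=> p00 np; have /andP[_ p01] := unit_quaternion_scalar_part np.
have [|T [Tp aT]] := @weil_arccos p0; first by rewrite p01 andbT; lra.
have [y ay] := weil_inverse aT.
exists (col3 (2 * y * p1) (2 * y * p2) (2 * y * p3)).
rewrite Exp_cross_mx.
set phi := col3 (2 * y * p1) _ _; set P := cross_mx (col3 p1 p2 p3).
have -> : (phi^T *m phi) 0 0 = 4 * T.
  (* The vector part has squared norm 1 - p0^2 with p0 = 1 - T b(T), that is T b(T) (2 - T b(T)). *)
  have vT : p1 ^+ 2 + p2 ^+ 2 + p3 ^+ 2 = T * aA T ^+ 2.
    rewrite weil_rodrigues_a_sqr.
    transitivity (1 - p0 ^+ 2); first by rewrite -np; ring.
    by rewrite -Tp; ring.
  rewrite sqr_norm3E !mxE /=.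
  transitivity (4 * y ^+ 2 * (p1 ^+ 2 + p2 ^+ 2 + p3 ^+ 2)); first by ring.
  rewrite vT; transitivity (4 * T * (aA T * y) ^+ 2); first by ring.
  by rewrite ay expr1n mulr1.
have -> : cross_mx phi = (2 * y) *: P.
  by apply/matrixP; do 2!apply: ord3_ind; rewrite !mxE /=; ring.
rewrite -scalemxAl -scalemxAr !scalerA quat_mxE // weil_rodrigues_a_mul4 Tp.
(* As [y] inverts a(T), the coefficients 2 y a(4T) and 4 y^2 b(4T) become those of [quat_mxE],
   namely 2 p0 and 2. *)
congr (_ + _ *: _ + _ *: _).
- by transitivity (2 * p0 * (aA T * y)); [rewrite ay mulr1 | ring].
- transitivity (2 * (aA T * y) ^+ 2); first by rewrite ay expr1n mulr1.
  by rewrite exprMn -weil_rodrigues_b_mul4; ring.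
Qed.

Lemma Exp_cross_mx_surjective (Q : 'M[A]_3) : in_SO3 Q ->
  exists phi, Q = Exp (cross_mx phi).
Proof.
move=> /quaternion_exists [p0 [p1 [p2 [p3 [-> np]]]]].
have [p00|p00] := leP 0 (scalar_part p0); first exact: Exp_quat_mx.
rewrite -quat_mxN; apply: Exp_quat_mx; last by rewrite !sqrrN.
by rewrite scalar_partN oppr_ge0 ltW.
Qed.

End Surjectivity.

Theorem theorem7p1 (R : realType) (A : weilAlgType R) :
  (forall Q : 'M[A]_3, in_SO3 Q ->
     exists B : 'M[A]_3, in_so3 B /\ Q = Exp B) /\
  (forall Q : 'M[A]_3, in_SO3 Q ->
     exists phi : 'cV[A]_3,
       let B := cross_mx phi in
       let S : A := (phi^T *m phi) 0 0 in
       Q = Exp B /\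
       Exp B = 1%:M + weil_prolongation1 (@rodrigues_a R) S *: B
                    + weil_prolongation1 (@rodrigues_b R) S *: (B *m B)).
Proof.
split=> Q /Exp_cross_mx_surjective [phi Qphi].
  by exists (cross_mx phi); split; first exact: cross_mx_so3.
by exists phi; split=> //; apply: Exp_cross_mx.
Qed.
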